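(* Let $(X_t)$ be a strictly stationary sequence of real random variables for which there are $\alpha\in(0,2)$ and a normalizing sequence $(a_n)$ with $nP(|X_0|>a_nx)\to x^{-\alpha}$ as $n\to\infty$ for every $x>0$, and for which the limit $\lim_{x\to\infty}P(X_0>x)/P(|X_0|>x)$ exists. Let $p=p_n$ be a positive-integer-valued sequence with $p_n\to\infty$ as $n\to\infty$ and $$\limsup_{n\to\infty}\frac{p_n}{n^{\beta}}<\infty$$ for some $\beta>0$ which satisfies $\beta<\frac{2-\alpha}{\alpha-1}$ if $1<\alpha<2$. Assume that there exists $b\ge 0$ such that $$p\,P\Big(\sum_{t=1}^nX_t^2>a_{np}^2x\Big)\longrightarrow b\,x^{-\alpha/2}\quad (n\to\infty)\qquad\text{for each }x>0.$$ Let $\mathbf X=(X_{it})_{1\le i\le p,\,1\le t\le n}$ be the $p\times n$ random matrix whose rows $(X_{it})_{1\le t\le n}$, $i=1,\dots,p$, are independent copies of $(X_t)_{1\le t\le n}$, and let $\lambda_1,\dots,\lambda_p\ge0$ be the eigenvalues of $\mathbf X\mathbf X^{\mathsf T}$. Then, as $n\to\infty$, $$\sum_{i=1}^p\epsilon_{a_{np}^{-2}\lambda_i}\ \xrightarrow{D}\ \sum_{i=1}^\infty\epsilon_{b^{2/\alpha}\Gamma_i^{-2/\alpha}},$$ where $\Gamma_i=E_1+\dots+E_i$ and $(E_k)$ are independent and identically distributed exponential random variables with mean one.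
   Context: $\epsilon_x$ denotes the Dirac (unit point) measure at $x$. The point processes in the conclusion are regarded as point processes on $(0,\infty)$: for $B\subseteq(0,\infty)$, $\sum_{i=1}^p\epsilon_{a_{np}^{-2}\lambda_i}(B)$ is the number of $1\le i\le p$ with $a_{np}^{-2}\lambda_i\in B$ (points at $0$ are not counted). Here $a_{np}$ is the term of the sequence $(a_m)$ with index $m=n\,p_n$. The convergence $\xrightarrow{D}$ in the conclusion means that for every continuous $f:(0,\infty)\to[0,\infty)$ with compact support, $E\big(e^{-\sum_{i=1}^pf(a_{np}^{-2}\lambda_i)}\big)\to E\big(e^{-\sum_{i=1}^\infty f(b^{2/\alpha}\Gamma_i^{-2/\alpha})}\big)$, with $f(0)$ read as $0$. *)

(* Defs.v *)
From HB Require Import structures.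
From mathcomp Require Import all_boot all_order all_algebra finmap.
From mathcomp Require Import all_classical all_reals all_analysis.

Set Implicit Arguments.
Unset Strict Implicit.
Unset Printing Implicit Defensive.

Import Order.TTheory GRing.Theory Num.Theory.
Import numFieldNormedType.Exports.

Local Open Scope classical_set_scope.
Local Open Scope ring_scope.

(* The two maps may live on different probability spaces. *)
Definition eq_law (R : realType) (d1 d2 d' : measure_display)
    (T1 : measurableType d1) (T2 : measurableType d2) (U : measurableType d')
    (P1 : probability T1 R) (P2 : probability T2 R)
    (Y1 : T1 -> U) (Y2 : T2 -> U) : Prop :=
  forall B : set U, measurable B -> P1 (Y1 @^-1` B) = P2 (Y2 @^-1` B).

(* The values in [U] may be vectors: [n.-tuple R] carries the product
   sigma-algebra, so this also expresses independence of random vectors. *)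
Definition mutually_independent (R : realType) (d d' : measure_display)
    (T : measurableType d) (U : measurableType d') (I : choiceType)
    (P : probability T R) (Y : I -> T -> U) : Prop :=
  forall (J : {fset I}) (B : I -> set U), (forall i, measurable (B i)) ->
    P (\bigcap_(i in [set` J]) (Y i @^-1` B i)) =
    (\prod_(i <- J) P (Y i @^-1` B i))%E.

Definition strictly_stationary (R : realType) (d : measure_display)
    (T : measurableType d) (P : probability T R)
    (X : nat -> T -> R) : Prop :=
  forall (k : nat) (t : k.-tuple nat) (h : nat),
    eq_law P P (fun w => [tuple X (tnth t i) w | i < k])
               (fun w => [tuple X (tnth t i + h)%N w | i < k]).

(* [l] lists the eigenvalues of [A] with their algebraic multiplicities. *)
Definition eigenvalues_of (R : realType) (n : nat) (A : 'M[R]_n)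
    (l : 'I_n -> R) : Prop :=
  char_poly A = \prod_(i < n) ('X - (l i)%:P).

(* A continuous function ]0, +oo[ -> [0, +oo[ with compact support, given by an
   arbitrary (junk) extension to the whole line. *)
Definition pos_test_function (R : realType) (f : R -> R) : Prop :=
  [/\ {in `]0, +oo[, continuous f},
      forall x, 0 < x -> 0 <= f x &
      exists K : set R, [/\ compact K, K `<=` [set x | 0 < x] &
        forall x, 0 < x -> ~ K x -> f x = 0]].

(* The integral of [f] against the point measure on ]0, +oo[ with points [x i];
   points outside ]0, +oo[ are not counted. *)
Definition fin_point_integral (R : realType) (n : nat) (x : 'I_n -> R)
    (f : R -> R) : \bar R :=
  (\sum_(i < n) ((f \_ [set y | (0 < y)%R]) (x i))%:E)%E.

Definition point_integral (R : realType) (x : nat -> R) (f : R -> R) : \bar R :=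
  (\sum_(0 <= i <oo) ((f \_ [set y | (0 < y)%R]) (x i))%:E)%E.

(* [expeR] sends -oo to 0. *)
Definition laplace (R : realType) (d : measure_display) (T : measurableType d)
    (P : probability T R) (S : T -> \bar R) : \bar R :=
  (\int[P]_w expeR (- S w))%E.

(* Main.v *)
Require Import Defs.
From HB Require Import structures.
From mathcomp Require Import all_boot all_order all_algebra finmap.
From mathcomp Require Import perm fingroup complex spectral sesquilinear.
From mathcomp Require Import all_classical all_reals all_analysis.
From mathcomp Require Import measurable_realfun.
From mathcomp Require Import lra ring zify.

Set Implicit Arguments.
Unset Strict Implicit.
Unset Printing Implicit Defensive.

Import Order.TTheory GRing.Theory Num.Theory.
Import numFieldNormedType.Exports.

Local Open Scope classical_set_scope.
Local Open Scope ring_scope.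

(** The proof compares the Laplace functionals of the two point processes at a
    test function f, extended by zero to the half-line of nonpositive reals.
    Write S i for the energy of row i divided by a(np)^2, that is, the i-th
    diagonal entry of the scaled matrix.

    Diagonal dominance. The diagonal entries of X X^T are sums of squares, of
    tail index alpha/2, while the off-diagonal ones are sums of products of two
    independent variables of tail index alpha, which are of smaller order than
    a(np)^2. By Weyl's inequality the eigenvalues, suitably permuted, differ
    from the diagonal entries by at most the largest off-diagonal absolute row
    sum (weyl_perm). Some row sum exceeds del a(np)^2 only if the random
    variable overflow is at least 1 (overflow_ge1). For r < alpha < s, the
    independence of the rows, the finiteness of the r-th absolute moment
    (moment_finite) and the lower bound a(m)^s >= c m (norming_lower) bound the
    expectation of overflow by a power of n; with r and s close to alpha, its
    exponent is negative exactly under the growth condition on p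
    (exponent_choice, overflow_rate). As f is uniformly continuous and vanishes
    near 0, replacing every eigenvalue by the corresponding S i is then
    asymptotically harmless (laplace_rows).

    The diagonal. The S i are independent with a common law, so their Laplace
    functional is (1 - u)^p with u the expectation of 1 - exp (- f (S 0)). The
    tail hypothesis says that p times the law of S 0 has in the limit the same
    tails b x^(-alpha/2) as the image of Lebesgue measure on the positive
    half-line under y |-> b^(2/alpha) y^(-2/alpha). Hence p u tends to the
    integral I of 1 - exp (- f) against that image measure (vague_cvg_tails),
    and (1 - u)^p tends to exp (- I).

    The limit. The Gamma i are the arrival times of a Poisson process of unit
    rate, so the Laplace functional of the limiting process is exp (- I) as well
    (laplace_poisson). This is proved by a thinned_martingale: with
    q = 1 - exp (- phi), the product of the 1 - q (Gamma i) over i <= N times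
    the exponential of minus the integral of q beyond Gamma N has an
    expectation independent of N, which is exp (- I) for N = 0. The last
    factor is 1 as soon as Gamma N has left the support of q. *)

(** * Eigenvalues of a nearly diagonal symmetric matrix *)

Lemma char_poly_similar (F : fieldType) n (P D : 'M[F]_n) :
  P \in unitmx -> char_poly (invmx P *m D *m P) = char_poly D.
Proof.
move=> uP.
have mapP : map_mx (@polyC F) (invmx P) *m map_mx (@polyC F) P = 1%:M.
  by rewrite -map_mxM mulVmx// map_mx1.
rewrite /char_poly.
have -> : char_poly_mx (invmx P *m D *m P) =
    map_mx (@polyC F) (invmx P) *m char_poly_mx D *m map_mx (@polyC F) P.
  rewrite /char_poly_mx mulmxBr mulmxBl !map_mxM; congr (_ - _).
  by rewrite scalar_mxC -mulmxA mapP mulmx1.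
by rewrite !det_mulmx mulrAC -det_mulmx mapP det1 mul1r.
Qed.

Local Notation toC R := (real_complex R).
Local Notation "M ^t*" := (map_mx Num.conj (trmx M)) (at level 30).

(** The complex spectral theorem diagonalises A in some order; both lists of
    eigenvalues split the same characteristic polynomial, so a permutation of
    the rows of the unitary matrix brings them into the order of l. *)
Lemma real_spectral (R : realType) n (A : 'M[R]_n) (l : 'I_n -> R) :
  A^T = A -> eigenvalues_of A l ->
  exists P : 'M[R[i]]_n, [/\ P *m P^t* = 1%:M, P^t* *m P = 1%:M &
    map_mx (toC R) A = P^t* *m diag_mx (\row_i (toC R (l i))) *m P].
Proof.
move=> Asym Al; set AC := map_mx _ A.
have ACn : AC \is normalmx.
  apply: symmetric_normalmx.
    by apply/is_hermitianmxP; rewrite expr0 scale1r map_mx_id// map_trmx Asym.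
  by apply/mxOverP => i j; rewrite mxE complex_real.
have /orthomx_spectralP := ACn.
set Q := spectralmx AC; set sp := spectral_diag AC => ACE.
have Qu : Q \is unitarymx by exact: spectral_unitarymx.
have Qunit : Q \in unitmx by exact: unitarymx_unit.
have lsp : perm_eq [tuple sp 0 i | i < n] [tuple (toC R (l i)) | i < n].
  apply: prod_XsubC_eq; rewrite !big_tuple /=.
  under eq_bigr do rewrite tnth_mktuple.
  under [RHS]eq_bigr do rewrite tnth_mktuple.
  transitivity (char_poly AC).
    rewrite ACE char_poly_similar//.
    rewrite char_poly_trig ?diag_mx_is_trig//.
    by apply: eq_bigr => i _; rewrite mxE eqxx.
  rewrite -map_char_poly Al.
  exact: map_prod_XsubC.
have /tuple_permP[s spl] := lsp.
have {}spl i : sp 0 i = toC R (l (s i)).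
  have /(congr1 (fun t : n.-tuple _ => tnth t i)) : [tuple sp 0 i | i < n] =
      [tuple tnth [tuple (toC R (l i)) | i < n] (s i) | i < n].
    exact: val_inj.
  by rewrite !tnth_mktuple.
have QQ : Q *m Q^t* = 1%:M by exact/unitarymxP.
have invQ : invmx Q = Q^t* by exact: invmx_unitary.
(* s sends the indices of the eigenvalue list of the spectral theorem to those of l. *)
exists (perm_mx s^-1%g *m Q).
have PtE : (perm_mx s^-1%g *m Q)^t* = Q^t* *m perm_mx s.
  by rewrite trmx_mul map_mxM tr_perm_mx invgK map_perm_mx.
have pp : perm_mx s^-1%g *m perm_mx s = 1%:M :> 'M[R[i]]_n.
  by rewrite -perm_mxM mulVg perm_mx1.
have pp' : perm_mx s *m perm_mx s^-1%g = 1%:M :> 'M[R[i]]_n.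
  by rewrite -perm_mxM mulgV perm_mx1.
rewrite PtE; split.
- by rewrite mulmxA -(mulmxA _ Q) QQ mulmx1 pp.
- by rewrite -mulmxA (mulmxA (perm_mx s)) pp' mul1mx -invQ mulVmx.
- rewrite ACE invQ -!mulmxA; congr (_ *m _); rewrite !mulmxA; congr (_ *m _).
  apply/matrixP => i j; rewrite -row_permE -col_permE !mxE spl.
  by rewrite (inj_eq perm_inj).
Qed.

(** The n - #|J| equations on the coordinates of u P outside J have a nonzero
    solution among the vectors with #|I| free coordinates. *)
Lemma unitary_supported (R : realType) n (P : 'M[R[i]]_n) (I J : {set 'I_n}) :
  (n < #|I| + #|J|)%N ->
  exists u : 'rV[R[i]]_n, [/\ u != 0, forall i, i \notin I -> u 0 i = 0 &
    forall j, j \notin J -> (u *m P) 0 j = 0].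
Proof.
move=> nIJ.
pose f (k : 'I_#|I|) : 'I_n := enum_val k.
pose g (k : 'I_#|~: J|) : 'I_n := enum_val k.
pose K := mxsub f g P.
have rK : (\rank (kermx K) != 0)%N.
  rewrite mxrank_ker -lt0n subn_gt0 (leq_ltn_trans (rank_leq_col _))//.
  by have := cardsC J; rewrite card_ord => JE; lia.
have [k kK0] : exists k, row k (kermx K) != 0.
  apply/existsP; apply: contra_neqT rK => /existsPn rK.
  apply/eqP; rewrite mxrank_eq0; apply/eqP/row_matrixP => k.
  by have /negPn/eqP -> := rK k; rewrite row0.
pose u' := row k (kermx K).
have u'K : u' *m K = 0 by rewrite -row_mul mulmx_ker row0.
exists (u' *m rowsub f 1%:M); split.
- apply: contra_neq kK0 => /rowP u0; apply/rowP => i; rewrite [RHS]mxE.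
  have := u0 (f i); rewrite [RHS]mxE [LHS]mxE (bigD1 i)//=.
  rewrite big1 ?addr0 => [|j ji]; last first.
    by rewrite !mxE (inj_eq enum_val_inj) (negbTE ji) mulr0.
  by rewrite !mxE eqxx mulr1.
- move=> i iI; rewrite mxE big1// => j _; rewrite !mxE.
  have [fji|] := eqVneq (f j) i; last by rewrite mulr0.
  by rewrite -fji enum_valP in iI.
- move=> j jJ; rewrite -mulmxA.
  have -> : rowsub f 1%:M *m P = rowsub f P by rewrite mul_rowsub_mx mul1mx.
  have jJ' : j \in ~: J by rewrite inE.
  have := congr1 (fun M : 'rV_(#|~: J|) => M 0 (enum_rank_in jJ' j)) u'K.
  rewrite [RHS]mxE [LHS]mxE => u0; rewrite -[RHS]u0 mxE.
  apply: eq_bigr => i _.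
  by rewrite !mxE /g enum_rankK_in.
Qed.

(** Schur's test: 2 |x i| |x j| <= x i ^ 2 + x j ^ 2, and the rows and the columns
    of a symmetric matrix have the same absolute sums. *)
Lemma offdiag_form_le (R : realType) n (A : 'M[R]_n) (x : 'I_n -> R) del :
  A^T = A -> (forall i, \sum_(j | j != i) `|A i j| <= del) ->
  \sum_i \sum_(j | j != i) `|A i j| * (`|x i| * `|x j|) <=
  del * \sum_i x i ^+ 2.
Proof.
move=> Asym Adel.
have le1 : \sum_i \sum_(j | j != i) `|A i j| * (`|x i| * `|x j|) <=
   \sum_i \sum_(j | j != i) (`|A i j| * (x i ^+ 2 / 2) + `|A i j| * (x j ^+ 2 / 2)).
  apply: ler_sum => i _; apply: ler_sum => j _; rewrite -mulrDr.
  apply: ler_wpM2l => //; rewrite -[x i ^+ 2]real_normK ?num_real//.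
  rewrite -[x j ^+ 2]real_normK ?num_real//.
  by have := sqr_ge0 (`|x i| - `|x j|); nra.
apply: (le_trans le1).
under eq_bigr do rewrite big_split/=.
rewrite big_split/= [X in _ + X](_ : _ =
    \sum_i \sum_(j | j != i) `|A i j| * (x i ^+ 2 / 2)); last first.
  rewrite (exchange_big_dep predT)//=.
  apply: eq_bigr => j _; apply: eq_big => [i|i _].
    by rewrite eq_sym.
  by rewrite -[in LHS]Asym mxE.
rewrite -big_split/= mulr_sumr; apply: ler_sum => i _.
rewrite -big_split/=.
under eq_bigr do rewrite -mulrDr -splitr.
by rewrite -mulr_suml ler_wpM2r ?sqr_ge0.
Qed.

(** The variational argument behind Weyl's inequality. Take a vector supported on
    the eigenvectors in I whose coordinates in the standard basis are supported
    in J. Its quadratic form is the mean of l with weights p in the eigenbasis,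
    and the mean of the diagonal with weights q up to the off-diagonal part. *)
Lemma weyl_weights (R : realType) n (A : 'M[R]_n) (l : 'I_n -> R)
    (I J : {set 'I_n}) (del : R) :
  A^T = A -> eigenvalues_of A l ->
  (forall i, \sum_(j | j != i) `|A i j| <= del) -> (n < #|I| + #|J|)%N ->
  exists p q : 'I_n -> R,
    [/\ (forall i, 0 <= p i) /\ (forall i, 0 <= q i),
        (forall i, i \notin I -> p i = 0) /\ (forall j, j \notin J -> q j = 0),
        \sum_i p i = 1, \sum_i q i = 1 &
        `|\sum_i p i * l i - \sum_i q i * A i i| <= del].
Proof.
move=> Asym Al Adel nIJ.
have [P [PP1 PP2 AE]] := real_spectral Asym Al.
have [u [u0 uI vJ]] := unitary_supported P nIJ.
set v := u *m P in vJ.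
pose nu (w : 'rV[R[i]]_n) i : R := Normc.normc (w 0 i).
have nuE w i : toC R (nu w i ^+ 2) = w 0 i * (w 0 i)^*.
  by rewrite -normCK rmorphXn.
have vv : v *m v^t* = u *m u^t*.
  by rewrite /v trmx_mul map_mxM -mulmxA (mulmxA P) PP1 mul1mx.
have vAv : v *m map_mx (toC R) A *m v^t* =
    u *m diag_mx (\row_i (toC R (l i))) *m u^t*.
  rewrite AE /v trmx_mul map_mxM -!mulmxA (mulmxA P (P^t*)) PP1 mul1mx.
  by rewrite (mulmxA P (P^t*)) PP1 mul1mx.
clearbody v.
have dotE (w : 'rV[R[i]]_n) : (w *m w^t*) 0 0 = toC R (\sum_i nu w i ^+ 2).
  rewrite mxE rmorph_sum; apply: eq_bigr => i _.
  by rewrite !mxE -nuE.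
pose S := \sum_i nu u i ^+ 2.
have SE : S = \sum_i nu v i ^+ 2.
  by apply: (@complexI R); rewrite -!dotE vv.
have S0 : 0 < S.
  have S_ge0 : 0 <= S by apply: sumr_ge0 => i _; exact: sqr_ge0.
  rewrite lt_neqAle S_ge0 andbT; apply: contra_neq u0 => /esym S0.
  apply/rowP => i; rewrite mxE.
  have /eqP := S0; rewrite psumr_eq0; last by move=> k _; exact: sqr_ge0.
  move=> /allP/(_ i (mem_index_enum _)); rewrite sqrf_eq0 => /eqP.
  exact: Normc.eq0_normc.
have uDu : (u *m diag_mx (\row_i (toC R (l i))) *m u^t*) 0 0 =
    toC R (\sum_i nu u i ^+ 2 * l i).
  rewrite mxE rmorph_sum; apply: eq_bigr => i _.
  rewrite mul_mx_diag !mxE rmorphM/=.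
  by rewrite mulrAC -nuE.
have vAvE : (v *m map_mx (toC R) A *m v^t*) 0 0 =
    toC R (\sum_i nu v i ^+ 2 * A i i) +
    \sum_i \sum_(j | j != i) v 0 i * toC R (A i j) * (v 0 j)^*.
  rewrite mxE; under eq_bigr do rewrite mxE mulr_suml.
  rewrite exchange_big/= rmorph_sum -big_split/=; apply: eq_bigr => i _.
  rewrite (bigD1 i)//=; congr (_ + _); last first.
    by apply: eq_bigr => j _; rewrite !mxE.
  by rewrite !mxE rmorphM/= mulrAC -nuE.
have normCR (x : R) : `|toC R x| = toC R `|x|.
  by rewrite normc_def; congr (toC R _); rewrite /= expr0n addr0 sqrtr_sqr.
have key : `|\sum_i nu u i ^+ 2 * l i - \sum_i nu v i ^+ 2 * A i i| <= del * S.
  have le1 : `|toC R (\sum_i nu u i ^+ 2 * l i - \sum_i nu v i ^+ 2 * A i i)|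
     <= toC R (\sum_i \sum_(j | j != i) `|A i j| * (`|nu v i| * `|nu v j|)).
    rewrite rmorphB/= -uDu -vAv vAvE addrAC subrr add0r.
    rewrite (le_trans (ler_norm_sum _ _ _))// rmorph_sum ler_sum// => i _.
    rewrite (le_trans (ler_norm_sum _ _ _))// rmorph_sum ler_sum// => j _.
    rewrite !normrM norm_conjC !rmorphM/= mulrAC -mulrA.
    have nnu w k : `|nu w k| = nu w k.
      by rewrite ger0_norm// /nu; case: (w 0 k) => ? ?; exact: sqrtr_ge0.
    by rewrite !nnu normCR mulrA [leLHS]mulrC; exact: lexx.
  rewrite normCR lecR in le1.
  apply: (le_trans le1); rewrite SE.
  exact: offdiag_form_le.
exists (fun i => nu u i ^+ 2 / S), (fun i => nu v i ^+ 2 / S); split.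
- by split=> i; rewrite divr_ge0 ?sqr_ge0 ?ltW.
- by split=> i iN; rewrite /nu ?(uI _ iN) ?(vJ _ iN) Normc.normc0 expr0n mul0r.
- by rewrite -mulr_suml divff ?gt_eqF.
- by rewrite -mulr_suml -SE divff ?gt_eqF.
- under eq_bigr do rewrite mulrAC.
  under [X in _ - X]eq_bigr do rewrite mulrAC.
  by rewrite -!mulr_suml -mulrBl normrM normfV (gtr0_norm S0) ler_pdivrMr.
Qed.

Lemma sorting_perm (R : realType) n (l : 'I_n -> R) :
  exists s : 'S_n, forall i j : 'I_n, (i <= j)%N -> l (s j) <= l (s i).
Proof.
pose t := [tuple l i | i < n].
have /tuple_permP[s sE] : perm_eq (sort >=%R t) t by rewrite perm_sort.
exists s => i j ij.
have srt : sorted >=%R (sort >=%R t) by exact: sort_sorted (@ge_total _ R) _.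
have sz : size (sort >=%R t) = n by rewrite size_sort size_tuple.
have nthE (k : 'I_n) : nth 0 (sort >=%R t) k = l (s k).
  by rewrite sE -tnth_nth !tnth_mktuple.
rewrite -!nthE; apply: (sorted_leq_nth _ _ 0 srt) => //.
- by move=> x y z yx zx; exact: le_trans zx yx.
- by move=> x; exact: lexx.
- by rewrite inE sz.
- by rewrite inE sz.
Qed.

(** Match the k-th largest eigenvalue with the k-th largest diagonal entry. The
    k-th and lower eigenvalues and the k-th and higher diagonal entries are
    n + 1 indices in all, so weyl_weights applies to them and bounds the
    k-th diagonal entry from above; exchanging the roles gives the other bound. *)
Lemma weyl_perm (R : realType) n (A : 'M[R]_n) (l : 'I_n -> R) (del : R) :
  A^T = A -> eigenvalues_of A l ->
  (forall i, \sum_(j | j != i) `|A i j| <= del) ->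
  exists s : 'S_n, forall j, `|l (s j) - A j j| <= del.
Proof.
move=> Asym Al Adel.
have [s1 s1l] := sorting_perm l.
have [s2 s2A] := sorting_perm (fun i => A i i).
have above s (P : pred 'I_n) : #|((s : 'S_n) @: [set i | P i])%SET| = #|[pred i | P i]|.
  by rewrite card_imset//; [exact: cardsE|exact: perm_inj].
have cle (k : 'I_n) : (n < #|[pred i : 'I_n | i <= k]%N| + #|[pred i : 'I_n | k <= i]%N|)%N.
  have := cardUI [pred i : 'I_n | i <= k]%N [pred i : 'I_n | k <= i]%N.
  move=> <-; rewrite (eq_card (B := 'I_n)) ?card_ord; last first.
    by move=> i; rewrite !inE leq_total.
  rewrite -[ltnLHS]addn0 ltn_add2l; apply/card_gt0P; exists k.
  by rewrite !inE leqnn.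
exists (s2^-1 * s1)%g => j; rewrite permM; set k := (s2^-1)%g j.
have -> : j = s2 k by rewrite /k permKV.
have S1 (x : 'I_n -> R) (c : R) : \sum_i x i = 1 -> c = \sum_i x i * c.
  by move=> x1; rewrite -mulr_suml x1 mul1r.
(* First I collects the eigenvalues at most l (s1 k) and J the diagonal entries
at least A (s2 k) (s2 k); then the other way round. *)
rewrite ler_norml; apply/andP; split.
- have [|p [q [[p0 q0] [pI qJ] p1 q1 pq]]] :=
    weyl_weights (I := (s1 @: [set i | (k <= (i : 'I_n))%N])%SET)
      (J := (s2 @: [set i | ((i : 'I_n) <= k)%N])%SET) Asym Al Adel.
    by rewrite !above addnC cle.
  have ple : \sum_i p i * l i <= l (s1 k).
    rewrite [leRHS](S1 p)//; apply: ler_sum => i _.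
    have [/imsetP[m]|/pI->] := boolP (i \in (s1 @: [set i | (k <= (i : 'I_n))%N])%SET).
      by rewrite inE => km ->; rewrite ler_wpM2l// s1l.
    by rewrite !mul0r.
  have qge : A (s2 k) (s2 k) <= \sum_i q i * A i i.
    rewrite [leLHS](S1 q)//; apply: ler_sum => i _.
    have [/imsetP[m]|/qJ->] := boolP (i \in (s2 @: [set i | ((i : 'I_n) <= k)%N])%SET).
      by rewrite inE => km ->; rewrite ler_wpM2l// s2A.
    by rewrite !mul0r.
  by move: pq; rewrite ler_norml => /andP[]; lra.
- have [|p [q [[p0 q0] [pI qJ] p1 q1 pq]]] :=
    weyl_weights (I := (s1 @: [set i | ((i : 'I_n) <= k)%N])%SET)
      (J := (s2 @: [set i | (k <= (i : 'I_n))%N])%SET) Asym Al Adel.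
    by rewrite !above cle.
  have ple : l (s1 k) <= \sum_i p i * l i.
    rewrite [leLHS](S1 p)//; apply: ler_sum => i _.
    have [/imsetP[m]|/pI->] := boolP (i \in (s1 @: [set i | ((i : 'I_n) <= k)%N])%SET).
      by rewrite inE => km ->; rewrite ler_wpM2l// s1l.
    by rewrite !mul0r.
  have qge : \sum_i q i * A i i <= A (s2 k) (s2 k).
    rewrite [leRHS](S1 q)//; apply: ler_sum => i _.
    have [/imsetP[m]|/qJ->] := boolP (i \in (s2 @: [set i | (k <= (i : 'I_n))%N])%SET).
      by rewrite inE => km ->; rewrite ler_wpM2l// s2A.
    by rewrite !mul0r.
  by move: pq; rewrite ler_norml => /andP[]; lra.
Qed.

(** * Product formulas for independent random elements *)

Section independence.
Context (R : realType) (d : measure_display) (T : measurableType d)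
  (P : probability T R).

(** The law of the pair agrees with the product law on rectangles, hence
    everywhere, and Tonelli's theorem applies to the product law. *)
Lemma indep_pair_integral d1 d2 (U1 : measurableType d1) (U2 : measurableType d2)
    (V : T -> U1) (Y : T -> U2) (F : U1 * U2 -> \bar R) :
  measurable_fun setT V -> measurable_fun setT Y ->
  (forall A B, measurable A -> measurable B ->
    P (V @^-1` A `&` Y @^-1` B) = (P (V @^-1` A) * P (Y @^-1` B))%E) ->
  measurable_fun [set: U1 * U2] F -> (forall z, 0 <= F z)%E ->
  (\int[P]_w F (V w, Y w) = \int[P]_w \int[P]_w' F (V w, Y w'))%E.
Proof.
move=> mV mY VY mF F0.
pose V' : {mfun T >-> U1} := HB.pack V (isMeasurableFun.Build _ _ _ _ V mV).
pose Y' : {mfun T >-> U2} := HB.pack Y (isMeasurableFun.Build _ _ _ _ Y mY).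
have mVY : measurable_fun setT (fun w => (V w, Y w)).
  exact: measurable_fun_pair.
pose Z : {mfun T >-> (U1 * U2)%type} :=
  HB.pack (fun w => (V w, Y w)) (isMeasurableFun.Build _ _ _ _ _ mVY).
have ZE : forall X, measurable X ->
    (distribution P V' \x distribution P Y')%E X = distribution P Z X.
  by apply: product_measure_unique => A B mA mB; exact: VY.
transitivity (\int[distribution P Z]_z F z)%E.
  by rewrite ge0_integral_distribution.
transitivity (\int[(distribution P V' \x distribution P Y')%E]_z F z)%E.
  apply: eq_measure_integral => X mX _; exact: esym (ZE X mX).
rewrite fubini_tonelli1//= /fubini_F.
rewrite ge0_integral_distribution//=; last 2 first.
- exact: measurable_fun_fubini_tonelli_F.
- by move=> x; exact: integral_ge0.
apply: eq_integral => w _; rewrite ge0_integral_distribution//=.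
by apply: measurableT_comp => //; exact: measurable_pair1.
Qed.

(** The finite sets of indices in the definition of mutual independence are
    replaced by duplicate-free lists, over which one can argue by induction. *)
Lemma indep_seq d' (U : measurableType d') (I : choiceType) (Y : I -> T -> U)
    (s : seq I) (B : I -> set U) :
  mutually_independent P Y -> uniq s -> (forall i, measurable (B i)) ->
  P [set w | forall i, i \in s -> B i (Y i w)] = (\prod_(i <- s) P (Y i @^-1` B i))%E.
Proof.
move=> hY us mB.
have := hY [fset i in s]%fset B mB.
rewrite (perm_big s)/=; last first.
  by apply: uniq_perm => //= i; rewrite in_fset.
by move=> <-; congr (P _); apply/seteqP; split=> w /= wB i; have := wB i;
  rewrite /= in_fset.
Qed.

Definition seq_tuple d' (U : measurableType d') (I : choiceType)
  (Y : I -> T -> U) (s : seq I) (w : T) : (size s).-tuple U :=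
  [tuple Y (tnth (in_tuple s) k) w | k < size s].

Lemma measurable_seq_tuple d' (U : measurableType d') (I : choiceType)
    (Y : I -> T -> U) (s : seq I) :
  (forall i, measurable_fun setT (Y i)) -> measurable_fun setT (seq_tuple Y s).
Proof.
move=> mY; apply/measurable_fun_tnthP => k.
rewrite (_ : _ \o _ = Y (tnth (in_tuple s) k))//.
by apply/funext => w /=; rewrite /seq_tuple tnth_mktuple.
Qed.

(** The finite family along s is independent of one more variable: for fixed B both
    sides are finite measures in A which agree on boxes, and the boxes form a
    generating class closed under intersection. *)
Lemma indep_seq_tuple d' (U : measurableType d') (I : choiceType)
    (Y : I -> T -> U) (s : seq I) (i : I) (A : set ((size s).-tuple U))
    (B : set U) :
  (forall i, measurable_fun setT (Y i)) -> mutually_independent P Y ->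
  uniq (i :: s) -> measurable A -> measurable B ->
  P (seq_tuple Y s @^-1` A `&` Y i @^-1` B) =
    (P (seq_tuple Y s @^-1` A) * P (Y i @^-1` B))%E.
Proof.
move=> mY hY /= /andP[iNs us] mA mB.
have mV := measurable_seq_tuple (s := s) mY.
have mYB : measurable (Y i @^-1` B) by rewrite -[X in measurable X]setTI; exact: mY.
pose V' : {mfun T >-> (size s).-tuple U} :=
  HB.pack (seq_tuple Y s) (isMeasurableFun.Build _ _ _ _ _ mV).
pose m1' : {measure set _ -> \bar R} := pushforward (mrestr P mYB) V'.
pose m1 := m1' mV.
have Pfin : (0 <= fine (P (Y i @^-1` B)))%R by rewrite fine_ge0.
pose m2 : {measure set _ -> \bar R} :=
  mscale (NngNum Pfin) (distribution P V').
pose rect (C : I -> set U) : set ((size s).-tuple U) :=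
  [set v | forall k, C (tnth (in_tuple s) k) (tnth v k)].
pose G := [set X | exists2 C, (forall i, measurable (C i)) & X = rect C].
have PB : (fine (P (Y i @^-1` B)))%:E = P (Y i @^-1` B).
  by rewrite fineK ?fin_num_measure.
have rectE C : seq_tuple Y s @^-1` rect C = [set w | forall j, j \in s -> C j (Y j w)].
  apply/seteqP; split=> w /=.
    move=> h j js; have /(_ (Ordinal (etrans (index_mem _ _) js))) := h.
    by rewrite /seq_tuple tnth_mktuple (tnth_nth j)/= nth_index.
  by move=> h k; rewrite /seq_tuple tnth_mktuple; apply: h; exact: mem_tnth.
(* A cylinder is a box all of whose sides but one are full. *)
have mG : measurable = <<s G>>.
  apply/seteqP; split.
    apply: smallest_sub; first exact: smallest_sigma_algebra.
    move=> X; rewrite -bigcup_seq => -[k _ [C mC <-]].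
    apply: sub_sigma_algebra.
    exists (fun j => if j == tnth (in_tuple s) k then C else setT).
      by move=> j; case: ifP.
    rewrite setTI; apply/seteqP; split=> v /=.
      move=> Cv k'; case: eqVneq => // kk'.
      suff -> : k' = k by [].
      apply: val_inj; apply/eqP; rewrite -(nth_uniq (tnth (in_tuple s) k) (ltn_ord k') (ltn_ord k) us).
      by rewrite -!(tnth_nth _ (in_tuple s)) kk'.
    by move=> /(_ k); rewrite eqxx.
  apply: smallest_sub; first exact: sigma_algebra_measurable.
  move=> _ [C mC ->].
  rewrite (_ : rect C = \bigcap_(k in [set: 'I_(size s)])
      ((@tnth _ U ^~ k) @^-1` C (tnth (in_tuple s) k))); last first.
    by apply/seteqP; split=> v /= h k; have := h k => // /(_ Logic.I).
  apply: fin_bigcap_measurable => // k _.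
  by rewrite -[X in measurable X]setTI; exact: measurable_tnth.
rewrite -PB muleC; change (m1 A = m2 A).
apply: (measure_unique G (fun=> setT)) => //.
- move=> _ _ [C mC ->] [D mD ->]; exists (fun i => C i `&` D i).
    by move=> j; exact: measurableI.
  apply/seteqP; split=> v /=.
    by move=> [hC hD] k; split; [exact: hC|exact: hD].
  by move=> h; split=> k; have [] := h k.
- by move=> _; exists (fun=> setT) => //; apply/seteqP; split.
- by rewrite bigcup_const//; exists 0%N.
- move=> _ [C mC ->].
  change (P (seq_tuple Y s @^-1` rect C `&` Y i @^-1` B) =
    (fine (P (Y i @^-1` B)))%:E * P (seq_tuple Y s @^-1` rect C))%E.
  rewrite PB rectE.
  (* The box C intersected with the event on Y i is a box over i :: s. *)
  pose D j := if j == i then B else C j.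
  have mD j : measurable (D j) by rewrite /D; case: ifP.
  have := indep_seq hY (s := i :: s) _ mD; rewrite big_cons/= iNs us => /(_ isT).
  rewrite {2}/D eqxx => DE.
  rewrite (_ : _ `&` _ = [set w | forall j, j \in i :: s -> D j (Y j w)]); last first.
    apply/seteqP; split=> w /=.
      move=> [wC wB] j; rewrite inE /D; have [->//|ji /= js] := eqVneq j i.
      exact: wC.
    move=> h; split.
      move=> j js; have := h j; rewrite inE js orbT /D => /(_ isT).
      by case: eqVneq => // ji; rewrite -ji js in iNs.
    by have := h i; rewrite mem_head /D eqxx; exact.
  rewrite DE; congr (_ * _)%E.
  rewrite (indep_seq hY us mC); rewrite big_seq [RHS]big_seq.
  apply: eq_bigr => j js; rewrite /D; case: eqVneq => // ji.
  by rewrite -ji js in iNs.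
- move=> _; change (P (seq_tuple Y s @^-1` setT `&` Y i @^-1` B) < +oo)%E.
  by rewrite preimage_setT setTI (le_lt_trans (probability_le1 _ _)) ?ltry.
Qed.

Lemma indep_seq_tuple_integral d' (U : measurableType d') (I : choiceType)
    (Y : I -> T -> U) (s : seq I) (i : I) (F : (size s).-tuple U * U -> \bar R) :
  (forall i, measurable_fun setT (Y i)) -> mutually_independent P Y ->
  uniq (i :: s) ->
  measurable_fun [set: (size s).-tuple U * U] F -> (forall z, 0 <= F z)%E ->
  (\int[P]_w F (seq_tuple Y s w, Y i w) =
   \int[P]_w \int[P]_w' F (seq_tuple Y s w, Y i w'))%E.
Proof.
move=> mY hY us mF F0; apply: indep_pair_integral => //.
- exact: measurable_seq_tuple.
- by move=> A B; exact: indep_seq_tuple.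
Qed.

Lemma integral_prod_indep d' (U : measurableType d') (I : choiceType)
    (Y : I -> T -> U) (s : seq I) (g : I -> U -> R) :
  (forall i, measurable_fun setT (Y i)) -> mutually_independent P Y ->
  (forall i, measurable_fun setT (g i)) -> (forall i x, 0 <= g i x) -> uniq s ->
  (\int[P]_w (\prod_(i <- s) g i (Y i w))%:E =
   \prod_(i <- s) \int[P]_w (g i (Y i w))%:E)%E.
Proof.
move=> mY hY mg g0; elim: s => [_|i s IHs us].
  under eq_integral do rewrite big_nil.
  by rewrite integral_cst//= probability_setT mule1 big_nil.
have /andP[_ us'] : (i \notin s) && uniq s := us.
rewrite big_cons -IHs//.
have mgY j : measurable_fun setT (fun w => (g j (Y j w))%:E).
  by apply/measurable_EFinP; apply: measurableT_comp.
pose h (v : (size s).-tuple U) := \prod_(k < size s) g (tnth (in_tuple s) k) (tnth v k).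
have hE w : \prod_(j <- s) g j (Y j w) = h (seq_tuple Y s w).
  rewrite /h big_tnth; apply: eq_bigr => k _.
  by rewrite /seq_tuple tnth_mktuple.
have h0 v : 0 <= h v by exact: prodr_ge0.
have mh : measurable_fun setT h.
  apply: measurable_prod => k _; apply: measurableT_comp => //.
  exact: measurable_tnth.
pose F (z : (size s).-tuple U * U) := (h z.1 * g i z.2)%:E.
transitivity (\int[P]_w F (seq_tuple Y s w, Y i w))%E.
  by apply: eq_integral => w _; rewrite /F big_cons hE mulrC.
rewrite indep_seq_tuple_integral//; last 2 first.
- apply/measurable_EFinP; apply: measurable_funM.
    by apply: measurableT_comp.
  by apply: measurableT_comp.
- by move=> z; rewrite lee_fin mulr_ge0.
transitivity (\int[P]_w ((h (seq_tuple Y s w))%:E * \int[P]_w' (g i (Y i w'))%:E))%E.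
  apply: eq_integral => w _; rewrite /F/=.
  under eq_integral do rewrite EFinM.
  by rewrite ge0_integralZl_EFin// => w' _; rewrite lee_fin.
have mhY : measurable_fun setT (fun w => (h (seq_tuple Y s w))%:E).
  apply/measurable_EFinP; apply: measurableT_comp => //.
  exact: measurable_seq_tuple.
rewrite ge0_integralZr//; last 2 first.
- by move=> w _; rewrite lee_fin.
- by apply: integral_ge0 => w _; rewrite lee_fin.
rewrite muleC; congr (_ * _)%E; apply: eq_integral => w _.
by rewrite hE.
Qed.

End independence.

(** * The Laplace functional of the arrival times of a Poisson process *)

Section density.
Context d (T : measurableType d) (R : realType).
Variables (mu nu : {measure set T -> \bar R}) (h : T -> R).
Hypotheses (mh : measurable_fun setT h) (h0 : forall x, 0 <= h x)
  (nuE : forall A, measurable A -> nu A = (\int[mu]_(x in A) (h x)%:E)%E).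

Import HBNNSimple.

Let density_indic (A : set T) : measurable A ->
  (\int[nu]_x (\1_A x)%:E = \int[mu]_x ((\1_A x)%:E * (h x)%:E))%E.
Proof.
move=> mA; rewrite integral_indic// setIT nuE// integral_mkcond.
apply: eq_integral => x _; rewrite patchE indicE.
by case: ifPn => xA; rewrite ?mul1e ?mul0e.
Qed.

Let density_nnsfun (f : {nnsfun T >-> R}) :
  (\int[nu]_x (f x)%:E = \int[mu]_x ((f x)%:E * (h x)%:E))%E.
Proof.
under [LHS]eq_integral do rewrite fimfunE -fsumEFin//.
rewrite [LHS]ge0_integral_fsum//; last 2 first.
  - by move=> r; exact/measurable_EFinP/measurableT_comp.
  - by move=> n x _; rewrite EFinM nnfun_muleindic_ge0.
under [RHS]eq_integral.
  move=> x xD; rewrite fimfunE -fsumEFin// ge0_mule_fsuml; last first.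
    by move=> r; rewrite EFinM nnfun_muleindic_ge0.
  over.
rewrite [RHS]ge0_integral_fsum//; last 2 first.
  - move=> r; apply: emeasurable_funM; last exact/measurable_EFinP.
    by apply/measurable_EFinP/measurableT_comp.
  - move=> n x _; rewrite mule_ge0// ?lee_fin//.
    by rewrite -lee_fin EFinM nnfun_muleindic_ge0.
apply: eq_fsbigr => r; rewrite inE => -[t _ <-].
under eq_integral do rewrite EFinM.
under [RHS]eq_integral do rewrite EFinM -muleA.
rewrite !ge0_integralZl_EFin//; last 3 first.
- by move=> x _; rewrite mule_ge0// lee_fin.
- apply: emeasurable_funM; last exact/measurable_EFinP.
  by apply/measurable_EFinP/measurable_indic.
- by apply/measurable_EFinP/measurable_indic.
by rewrite density_indic.
Qed.

(** Equality holds on indicators by hypothesis, then on simple functions, and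
    passes to the limit by monotone convergence. *)
Lemma integral_density (f : T -> \bar R) :
  measurable_fun setT f -> (forall x, 0 <= f x)%E ->
  (\int[nu]_x f x = \int[mu]_x (f x * (h x)%:E))%E.
Proof.
move=> mf f0.
pose f_ := nnsfun_approx measurableT mf.
have f_f x : (f_ n x)%:E @[n --> \oo] --> f x by exact: cvg_nnsfun_approx.
transitivity (lim (\int[nu]_x (f_ n x)%:E @[n --> \oo])%E).
  rewrite -monotone_convergence//=.
  - by apply: eq_integral => x _; apply/esym/cvg_lim.
  - by move=> n; exact/measurable_EFinP/measurable_funTS.
  - by move=> n ? _; rewrite lee_fin.
  - by move=> ? _ ? ? mn; rewrite lee_fin; exact/lefP/nd_nnsfun_approx.
under eq_fun do rewrite density_nnsfun.
rewrite -monotone_convergence//=.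
- apply: eq_integral => x _; apply/cvg_lim => //.
  by apply: cvgeZr.
- move=> n; apply: emeasurable_funM; last exact/measurable_EFinP.
  exact/measurable_EFinP/measurable_funTS.
- by move=> n ? _; rewrite mule_ge0// lee_fin.
- move=> x _ m n mn; rewrite lee_wpmul2r ?lee_fin//.
  exact/lefP/nd_nnsfun_approx.
Qed.

End density.

Section poisson.
Context (R : realType).
Notation mu := (@lebesgue_measure R).
Variables (q : R -> R) (M : R).
Hypotheses (cq : continuous q) (q0 : forall x, 0 <= q x) (q1 : forall x, q x <= 1)
  (qL : forall x, x <= 0 -> q x = 0) (qR : forall x, M <= x -> q x = 0).

Let mq : measurable_fun setT q.
Proof. exact: continuous_measurable_fun. Qed.

Let q_out x : x \notin `[0, M] -> q x = 0.
Proof.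
rewrite in_itv/= negb_and -!ltNge => /orP[]/ltW; [exact: qL|exact: qR].
Qed.

Let iq : mu.-integrable setT (EFin \o q).
Proof.
have : mu.-integrable `[0, M] (EFin \o q).
  apply: continuous_compact_integrable; first exact: segment_compact.
  exact: continuous_subspaceT.
move=> /integrable_mkcond => /(_ (measurable_itv _)).
congr (mu.-integrable setT _); apply/funext => x; rewrite patchE/=.
by case: ifPn => // xN; rewrite q_out//; apply: contra xN; rewrite inE.
Qed.

(** The integral of q over the half-line beyond s, written as a difference so that
    the fundamental theorem of calculus applies to the second term. *)
Definition tail_mass (s : R) : R :=
  (\int[mu]_(x in setT) q x - \int[mu]_(x in `]-oo, s]) q x)%R.

Lemma tail_mass_deriv (s : R) : is_derive s (1 : R) tail_mass (- q s).
Proof.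
have [||||ds dE] := @continuous_FTC1 R q -oo%O s (s + 1).
- by rewrite ltrDl.
- exact: integrableS iq.
- by rewrite /= ltNyr.
- exact: cq.
rewrite /tail_mass -[X in is_derive _ _ _ X]sub0r.
apply: is_deriveB; apply: DeriveDef => //.
by rewrite -derive1E.
Qed.

Lemma tail_mass_left s : s <= 0 -> tail_mass s = \int[mu]_(x in setT) q x.
Proof.
move=> s0; rewrite /tail_mass.
have -> : \int[mu]_(x in `]-oo, s]) q x = 0; last by rewrite subr0.
rewrite (@eq_Rintegral _ _ _ mu _ (cst 0)) ?Rintegral_cst ?mul0r// => x.
by rewrite inE/= in_itv/= => xs; rewrite qL// (le_trans xs).
Qed.

Lemma tail_mass_right s : M <= s -> tail_mass s = 0.
Proof.
move=> Ms; apply/eqP; rewrite subr_eq0; apply/eqP.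
rewrite /Rintegral; congr fine.
rewrite [RHS]integral_mkcond; apply: eq_integral => x _; rewrite patchE.
case: ifPn => //; rewrite notin_setE/= in_itv/= => /negP; rewrite -ltNge => sx.
by rewrite qR// (le_trans Ms (ltW sx)).
Qed.

Lemma tail_mass_ge0 s : 0 <= tail_mass s.
Proof.
rewrite /tail_mass -[X in \int[_]_(x in X) _ - _]set_itvNyy Rintegral_itvB//.
  by apply: Rintegral_ge0.
by rewrite set_itvNyy; exact: iq.
Qed.

(** The probability that a Poisson process with intensity q has no point beyond s. *)
Definition void_prob (s : R) : R := expR (- tail_mass s).

Lemma is_derive_tail_comp (s x : R) :
  is_derive x (1 : R) (fun x => tail_mass (s + x)) (- q (s + x)).
Proof.
have -> : (fun x => tail_mass (s + x)) = tail_mass \o (cst s + id) by [].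
rewrite -[X in is_derive _ _ _ X]mulr1.
apply: is_derive1_comp; first exact: tail_mass_deriv.
by apply: is_derive_eq; rewrite add0r.
Qed.

(** One step of the martingale. If an arrival occurs at s and the next one after an
    exponential time x, then the next arrival stays unmarked with probability
    1 - q (s + x). The integrand is the derivative of
    - exp (- x) void_prob (s + x), as (void_prob)' = q void_prob. *)
Lemma exp_kernel (s : R) :
  (\int[mu]_(x in `[0%R, +oo[) (expR (- x) * ((1 - q (s + x)) * void_prob (s + x)))%:E
   = (void_prob s)%:E)%E.
Proof.
(* A primitive of the integrand that vanishes at infinity. *)
pose F : R -> R := - (expR \o (- id - (fun x => tail_mass (s + x)))).
have FE x : F x = - (expR (- x) * void_prob (s + x)) by rewrite /F /void_prob -expRD.
have dF (x : R) : is_derive x (1 : R) F (expR (- x) * ((1 - q (s + x)) * void_prob (s + x))).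
  have dt := is_derive_tail_comp s x.
  apply: is_derive_eq.
  rewrite /= !fctE expRD -/(void_prob (s + x)).
  by ring.
have cF (x : R) : {for x, continuous F}.
  by apply: differentiable_continuous; apply/derivable1_diffP; apply: ex_derive.
have ctail (x : R) : {for x, continuous (fun x => tail_mass (s + x))}.
  apply: differentiable_continuous; apply/derivable1_diffP.
  by have dt := is_derive_tail_comp s x; exact: ex_derive.
have cvoid (x : R) : {for x, continuous (fun x => void_prob (s + x))}.
  apply: (@continuous_comp _ _ _ (fun x => - tail_mass (s + x)) expR).
    exact: continuousN (ctail x).
  exact: continuous_expR.
rewrite (@ge0_continuous_FTC2y _ _ F 0 0).
- by rewrite FE oppr0 expR0 mul1r addr0 EFinN oppeK add0e.
- move=> x _; rewrite mulr_ge0 ?expR_ge0// mulr_ge0 ?expR_ge0//.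
  by rewrite subr_ge0.
- apply: continuous_subspaceT => x.
  apply: cvgM.
    by apply: continuous_comp; [exact: continuousN|exact: continuous_expR].
  apply: cvgM; last exact: cvoid.
  apply: cvgB; first exact: cvg_cst.
  apply: (@continuous_comp _ _ _ (fun x => s + x) q); last exact: cq.
  by apply: cvgD; [exact: cvg_cst|exact: cvg_id].
- rewrite -oppr0; apply: cvgN.
  have : expR (- x) @[x --> +oo] --> (0 : R) by exact: cvgr_expR.
  apply: cvg_trans; apply: near_eq_cvg; near=> x.
  rewrite /= !fctE tail_mass_right ?subr0// -lerBlDl.
  by near: x; apply: nbhs_pinfty_ge; rewrite num_real.
- by move=> x _; exact: ex_derive.
- by apply: cvg_at_right_filter; exact: cF.
- by move=> x _; rewrite derive1E; apply: derive_val.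
Unshelve. all: by end_near. Qed.
End poisson.

Section poisson_process.
Context (R : realType).
Notation mu := (@lebesgue_measure R).
Context d (T : measurableType d) (Q : probability T R) (E : nat -> {RV Q >-> R}).
Hypotheses (hE : mutually_independent Q (fun k w => E k w))
  (hEexp : forall k (B : set R), measurable B ->
    distribution Q (E k) B = exponential_prob 1 B).

Lemma integral_exp_law k (Phi : R -> R) :
  measurable_fun setT Phi -> (forall x, 0 <= Phi x) ->
  (\int[Q]_w (Phi (E k w))%:E =
   \int[mu]_(x in `[0%R, +oo[) (expR (- x) * Phi x)%:E)%E.
Proof.
move=> mPhi Phi0.
have mE : measurable_fun setT (E k : T -> measurableTypeR R).
  by have h := measurable_funPT (E k) => mT B mB; exact: (h mT B mB).
pose E' : {mfun T >-> measurableTypeR R} :=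
  HB.pack (E k : T -> measurableTypeR R) (isMeasurableFun.Build _ _ _ _ _ mE).
have D := @integral_density _ (measurableTypeR R) R mu (distribution Q E')
  (exponential_pdf 1) _ _ _ (EFin \o Phi) _ _.
apply: etrans; last (apply: etrans; [apply: D|]).
- by rewrite ge0_integral_distribution//; apply/measurable_EFinP.
- exact: measurable_exponential_pdf.
- by move=> x; apply: exponential_pdf_ge0.
- by move=> A mA; exact: hEexp.
- exact/measurable_EFinP.
- by move=> x; rewrite lee_fin.
rewrite [RHS]integral_mkcond; apply: eq_integral => x _.
rewrite /exponential_pdf !patchE; case: ifPn => _; last by rewrite mule0.
by rewrite /= mul1r mulN1r mulrC EFinM.
Qed.

Lemma laplace_exp k : (\int[Q]_w (expR (- E k w))%:E = (2^-1)%:E)%E.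
Proof.
rewrite (@integral_exp_law k (fun x => expR (- x))); last 2 first.
- by apply: measurableT_comp => //; exact: measurable_funN.
- by move=> x; exact: expR_ge0.
(* exp (- x) exp (- x) is half the exponential density of rate 2. *)
have two : (0 < 2 :> R) by [].
have := @integral_exponential_pdf R 2 two.
have -> : (\int[mu]_x (exponential_pdf 2 x)%:E =
    2%:E * \int[mu]_(x in `[0%R, +oo[) (expR (- x) * expR (- x))%:E)%E.
  rewrite -ge0_integralZl_EFin//.
  - rewrite [RHS]integral_mkcond; apply: eq_integral => x _.
    rewrite /exponential_pdf !patchE; case: ifPn => // _.
    by rewrite /= -expRD; congr ((_ * expR _)%:E); ring.
  - apply/measurable_EFinP/measurable_funTS; apply: measurable_funM;
      by apply: measurableT_comp => //; exact: measurable_funN.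
move=> /(congr1 (fun z => (2^-1)%:E * z)%E).
by rewrite muleA -EFinM mulVf// mul1e mule1.
Qed.

Variables (q : R -> R) (M : R).
Hypotheses (cq : continuous q) (q0 : forall x, 0 <= q x) (q1 : forall x, q x <= 1)
  (qL : forall x, x <= 0 -> q x = 0) (qR : forall x, M <= x -> q x = 0).

Definition arrival (k : nat) (w : T) : R := \sum_(i < k) E i w.

(** The conditional probability, given the arrival times, that a thinning which
    marks an arrival at x with probability q x marks none of the first N. *)
Definition thinned (N : nat) (w : T) : R := \prod_(i < N) (1 - q (arrival i.+1 w)).

Let q1_ge0 x : 0 <= 1 - q x.
Proof. by rewrite subr_ge0. Qed.

Let mq1 : measurable_fun setT (fun x => 1 - q x).
Proof. by apply: measurable_funB => //; exact: continuous_measurable_fun. Qed.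

Let mvoid : measurable_fun setT (void_prob q).
Proof.
apply: measurableT_comp => //; apply: measurable_funN.
apply: continuous_measurable_fun => x.
apply: differentiable_continuous; apply/derivable1_diffP.
by have dt := tail_mass_deriv cq qL qR x; exact: ex_derive.
Qed.

Lemma measurable_arrival k : measurable_fun setT (arrival k).
Proof. by apply: measurable_sum => i; exact: measurable_funPT. Qed.

Lemma measurable_thinned N : measurable_fun setT (thinned N).
Proof.
apply: measurable_prod => i _.
exact: measurableT_comp mq1 (measurable_arrival _).
Qed.

Lemma thinned_ge0 N w : 0 <= thinned N w.
Proof. exact: prodr_ge0. Qed.

Lemma thinned_le1 N w : thinned N w <= 1.
Proof.
by apply: prodr_ile1 => i _; rewrite q1_ge0/= gerBl.
Qed.

(** Integrate out the last waiting time first: it is independent of the previous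
    ones, and exp_kernel turns the factor of index N+1 into that of index N. *)
Lemma thinned_martingale N :
  (\int[Q]_w (thinned N w * void_prob q (arrival N w))%:E = (void_prob q 0)%:E)%E.
Proof.
elim: N => [|N IHN].
  under eq_integral do rewrite /thinned /arrival !big_ord0 mul1r.
  by rewrite integral_cst//= probability_setT mule1.
rewrite -IHN.
pose s := iota 0 N.
have szs : size s = N by rewrite size_iota.
have tnths (k : 'I_(size s)) : tnth (in_tuple s) k = k.
  by rewrite (tnth_nth 0%N)/= nth_iota// -szs.
(* arrival N and thinned N as functions of the tuple of the first N waiting
times. *)
pose G (v : (size s).-tuple R) := \sum_k tnth v k.
pose h (v : (size s).-tuple R) :=
  \prod_(i < N) (1 - q (\sum_(k < size s | (k < i.+1)%N) tnth v k)).
have GE w : G (seq_tuple (fun k w => E k w) s w) = arrival N w.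
  rewrite /G /arrival -szs; apply: eq_bigr => k _.
  by rewrite /seq_tuple tnth_mktuple tnths.
have hE' w : h (seq_tuple (fun k w => E k w) s w) = thinned N w.
  rewrite /h /thinned; apply: eq_bigr => i _; congr (1 - q _).
  rewrite /arrival (big_ord_widen (size s) (fun k => E k w)) ?szs ?ltn_ord//.
  by apply: eq_bigr => k _; rewrite /seq_tuple tnth_mktuple tnths.
have mG : measurable_fun setT G.
  by apply: measurable_sum => k; exact: measurable_tnth.
have mh : measurable_fun setT h.
  apply: measurable_prod => i _; apply: (measurableT_comp mq1).
  under eq_fun do rewrite big_mkcond.
  by apply: measurable_sum => k; case: (k < i.+1)%N => //; exact: measurable_tnth.
have h0 v : 0 <= h v by exact: prodr_ge0.
pose F (z : (size s).-tuple R * R) :=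
  (h z.1 * ((1 - q (G z.1 + z.2)) * void_prob q (G z.1 + z.2)))%:E.
have mGz : measurable_fun setT (fun z : (size s).-tuple R * R => G z.1 + z.2).
  by apply: measurable_funD => //; exact: measurableT_comp.
transitivity (\int[Q]_w F (seq_tuple (fun k w => E k w) s w, E N w))%E.
  apply: eq_integral => w _; rewrite /F/= GE hE' /thinned /arrival.
  by rewrite !big_ord_recr/= -mulrA.
rewrite (indep_seq_tuple_integral (Y := fun k w => E k w)) => //; last 3 first.
- by rewrite /= iota_uniq mem_iota add0n ltnn andbF.
- apply/measurable_EFinP; apply: measurable_funM; first exact: measurableT_comp.
  by apply: measurable_funM; [exact: measurableT_comp mq1 mGz|exact: measurableT_comp mvoid mGz].
- by move=> z; rewrite lee_fin mulr_ge0// mulr_ge0// expR_ge0.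
apply: eq_integral => w _; rewrite /F/= GE hE'.
have mPhi (c : R) : measurable_fun setT (fun x : R => (1 - q (c + x)) * void_prob q (c + x)).
  have mc : measurable_fun setT (fun x : R => c + x) by exact: measurable_funD.
  by apply: measurable_funM; [exact: measurableT_comp mq1 mc|exact: measurableT_comp mvoid mc].
under eq_integral do rewrite EFinM.
rewrite ge0_integralZl_EFin//; last 3 first.
- by move=> x _; rewrite lee_fin mulr_ge0// expR_ge0.
- by apply/measurable_EFinP; apply: (measurableT_comp (mPhi _)).
- exact: thinned_ge0.
rewrite (@integral_exp_law N (fun x => (1 - q (arrival N w + x)) * void_prob q (arrival N w + x))) //.
  by rewrite (exp_kernel cq q1 qL qR).
by move=> x; rewrite mulr_ge0// expR_ge0.
Qed.

End poisson_process.

Lemma cvg_EFinE (R : realType) (u : nat -> R) (l : R) :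
  (u n)%:E @[n --> \oo] --> l%:E <-> u n @[n --> \oo] --> l.
Proof.
split=> [/fine_cvg//|ul]; apply: cvg_EFin => //.
by apply: nearW.
Qed.

Lemma cvg_expRN_ereal (R : realType) (u : nat -> R) (l : \bar R) :
  (0 <= l)%E -> (u n)%:E @[n --> \oo] --> l ->
  (expR (- u n))%:E @[n --> \oo] --> expeR (- l).
Proof.
case: l => [r _|_|//].
  move=> /cvg_EFinE ur; apply/cvg_EFinE.
  exact: (cvg_comp _ _ (cvgN ur) (@continuous_expR R (- r))).
move=> uy0; have uy := (cvgeryP u).1 uy0.
apply/cvg_EFinE; exact: (@cvg_comp _ _ _ u (fun x => expR (- x)) _ _ _ (uy _) (@cvgr_expR R)).
Qed.

Section poisson_limit.
Context (R : realType).
Notation mu := (@lebesgue_measure R).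
Context d (T : measurableType d) (Q : probability T R) (E : nat -> {RV Q >-> R}).
Hypotheses (hE : mutually_independent Q (fun k w => E k w))
  (hEexp : forall k (B : set R), measurable B ->
    distribution Q (E k) B = exponential_prob 1 B).
Variables (q : R -> R) (M : R).
Hypotheses (cq : continuous q) (q0 : forall x, 0 <= q x) (q1 : forall x, q x <= 1)
  (qL : forall x, x <= 0 -> q x = 0) (qR : forall x, M <= x -> q x = 0).

Local Notation Gam := (arrival E).
Local Notation surv := (thinned E q).

(** A quantitative form of the divergence of the arrival times, which tells how
    rarely the N-th one still lies in the support of q. *)
Lemma laplace_arrival N : (\int[Q]_w (expR (- Gam N w))%:E = (2^-1 ^+ N)%:E)%E.
Proof.
have prodE w : expR (- Gam N w) = \prod_(k <- iota 0 N) expR (- E k w).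
  rewrite -[iota 0 N](_ : index_iota 0 N = _) ?big_mkord; last by rewrite /index_iota subn0.
  by rewrite /arrival -sumrN expR_sum.
under eq_integral do rewrite prodE.
rewrite (integral_prod_indep (Y := fun k w => E k w) (g := fun _ x => expR (- x)))//.
- under eq_bigr do rewrite (laplace_exp hEexp).
  by rewrite big_const_seq count_predT size_iota; elim: N {prodE} => //= N ->;
    rewrite -EFinM exprS.
- by move=> _; apply: measurableT_comp => //; exact: measurable_funN.
- exact: iota_uniq.
Qed.

(** The martingale has constant expectation void_prob q 0, and differs from
    thinned N only when the N-th arrival is before M, where the indicator of
    this event is at most exp (M - arrival N). *)
Lemma cvg_integral_thinned :
  (\int[Q]_w (surv N w)%:E)%E @[N --> \oo] --> (expR (- \int[mu]_x q x)%R)%:E.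
Proof.
(* exp M 2^-N is the integral of exp (M - arrival N). *)
pose ub N : \bar R := (void_prob q 0 + expR M * 2^-1 ^+ N)%:E.
have void_prob0 : void_prob q 0 = expR (- \int[mu]_x q x) by rewrite /void_prob tail_mass_left.
have mthin N : measurable_fun setT (fun w => (surv N w)%:E).
  by apply/measurable_EFinP; exact: measurable_thinned.
have tpE N : (\int[Q]_w (surv N w * void_prob q (Gam N w))%:E = (void_prob q 0)%:E)%E.
  exact: (thinned_martingale hE hEexp cq q1 qL qR).
have void_le1 x : void_prob q x <= 1.
  by rewrite -expR0 ler_expR oppr_le0 (tail_mass_ge0 cq q0 qL qR).
have mvoid : measurable_fun setT (void_prob q).
  apply: measurableT_comp => //; apply: measurable_funN.
  apply: continuous_measurable_fun => x.
  apply: differentiable_continuous; apply/derivable1_diffP.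
  by have dt := tail_mass_deriv cq qL qR x; exact: ex_derive.
have mtp N : measurable_fun setT (fun w => (surv N w * void_prob q (Gam N w))%:E).
  apply/measurable_EFinP; apply: measurable_funM; first exact: measurable_thinned.
  exact: measurableT_comp mvoid (measurable_arrival _ _).
have mexp N : measurable_fun setT (fun w => (expR M * expR (- Gam N w))%:E).
  apply/measurable_EFinP; apply: measurable_funM => //.
  by apply: measurableT_comp => //; apply: measurable_funN; exact: measurable_arrival.
apply: (@squeeze_cvge _ _ _ _ (fun=> (void_prob q 0)%:E) _ ub).
- apply: nearW => N; apply/andP; split.
    rewrite -(tpE N); apply: ge0_le_integral => //.
    - by move=> w _; rewrite lee_fin mulr_ge0 ?expR_ge0// thinned_ge0.
    - by move=> w _; rewrite lee_fin ler_piMr// thinned_ge0.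
  rewrite /ub EFinD -(tpE N).
  have -> : (expR M * 2^-1 ^+ N)%:E = (\int[Q]_w (expR M * expR (- Gam N w))%:E)%E.
    rewrite EFinM -laplace_arrival -ge0_integralZl_EFin//.
    - apply/measurable_EFinP; apply: measurableT_comp => //.
      by apply: measurable_funN; exact: measurable_arrival.
  rewrite -ge0_integralD//.
  - apply: ge0_le_integral => //.
    - by move=> w _; rewrite lee_fin thinned_ge0.
    - by apply: emeasurable_funD.
    - move=> w _; rewrite -EFinD lee_fin.
      have [Ma|aM] := leP M (Gam N w).
        rewrite /void_prob (tail_mass_right qR)// oppr0 expR0 mulr1 lerDl.
        by rewrite mulr_ge0 ?expR_ge0.
      apply: (@le_trans _ _ 1); first exact: thinned_le1.
      rewrite -[leLHS]add0r lerD//.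
        by rewrite mulr_ge0 ?expR_ge0// thinned_ge0.
      by rewrite -expRD -expR0 ler_expR subr_ge0 ltW.
  - by move=> w _; rewrite lee_fin mulr_ge0 ?expR_ge0// thinned_ge0.
- by rewrite void_prob0; exact: cvg_cst.
- rewrite -void_prob0; apply/cvg_EFinE.
  have : (void_prob q 0 + expR M * 2^-1 ^+ N : R) @[N --> \oo] --> void_prob q 0 + expR M * 0.
    apply: cvgD; first exact: cvg_cst.
    apply: cvgM; first exact: cvg_cst.
    by apply: cvg_expr; rewrite ger0_norm// invf_lt1// ltr1n.
  by rewrite mulr0 addr0.
Qed.

Lemma exp_ge0_ae : {ae Q, forall w, forall k, 0 <= E k w}.
Proof.
apply: ae_foralln => k; exists [set w | E k w < 0]; split.
- by rewrite -[X in measurable X]setTI; apply: measurable_fun_ltr => //; exact: measurable_funPT.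
- have mN : measurable `]-oo, (0:R)[ by [].
  have := hEexp k mN.
  rewrite /distribution /pushforward => E0.
  transitivity (Q (E k @^-1` `]-oo, 0[)).
    by congr (Q _); apply/seteqP; split=> w /=; rewrite in_itv.
  rewrite E0 /exponential_prob integral0_eq// => x; rewrite /= in_itv/= => x0.
  by rewrite lt0_exponential_pdf.
- by move=> w /= /negP; rewrite -ltNge.
Qed.

(** The partial sums increase to the series, so that the Laplace functional is the
    limit of the integrals of exp (- S N), and exp (- S N) is the product
    thinned N because q = 1 - exp (- phi) at the (almost surely nonnegative)
    arrival times. *)
Lemma laplace_poisson (phi : R -> R) :
  measurable_fun setT phi -> (forall x, 0 <= phi x) ->
  (forall x, 0 <= x -> q x = 1 - expR (- phi x)) ->
  laplace Q (fun w => \sum_(0 <= i <oo) (phi (Gam i.+1 w))%:E)%E =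
  (expR (- \int[mu]_x q x)%R)%:E.
Proof.
move=> mphi phi0 qE.
pose S N w : R := \sum_(0 <= i < N) phi (Gam i.+1 w).
pose Soo w : \bar R := (\sum_(0 <= i <oo) (phi (Gam i.+1 w))%:E)%E.
have Soo0 w : (0 <= Soo w)%E by apply: nneseries_ge0 => i _ _; rewrite lee_fin.
have S_Soo w : (S N w)%:E @[N --> \oo] --> Soo w.
  rewrite /S; under eq_fun do rewrite -sumEFin.
  by apply: is_cvg_nneseries => i _ _; rewrite lee_fin.
have mS N : measurable_fun setT (S N).
  apply: measurable_sum => i.
  exact: measurableT_comp mphi (measurable_arrival _ _).
have mexpS N : measurable_fun setT (fun w => (expR (- S N w))%:E).
  apply/measurable_EFinP; apply: measurableT_comp => //.
  exact: measurable_funN.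
have expS w : (expR (- S N w))%:E @[N --> \oo] --> expeR (- Soo w).
  exact: cvg_expRN_ereal.
have mexpSoo : measurable_fun setT (fun w => expeR (- Soo w)).
  apply: (emeasurable_fun_cvg (fun N w => (expR (- S N w))%:E)) => // w _.
have [|||||_ _ lim1] := @dominated_convergence _ _ _ Q setT measurableT
    (fun N w => (expR (- S N w))%:E) (fun w => expeR (- Soo w)) (cst 1%E).
  - exact: mexpS.
  - exact: mexpSoo.
  - by apply: aeW => w _; exact: expS.
  - by apply: finite_measure_integrable_cst.
  - apply: aeW => w N _; rewrite lee_fin ger0_norm ?expR_ge0//.
    by rewrite -expR0 ler_expR oppr_le0; apply: sumr_ge0.
have lim2 : (\int[Q]_w (expR (- S N w))%:E)%E @[N --> \oo] --> (expR (- \int[mu]_x q x)%R)%:E.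
  have := cvg_integral_thinned; apply: cvg_trans; apply: near_eq_cvg.
  apply: nearW => N; apply: ae_eq_integral => //.
    by apply/measurable_EFinP; exact: measurable_thinned.
  have := exp_ge0_ae; apply: filterS => w Ew _; congr EFin.
  rewrite /thinned /S big_mkord -sumrN expR_sum; apply: eq_bigr => i _.
  by rewrite qE; [rewrite subKr|apply: sumr_ge0].
exact: (cvg_unique _ lim1 lim2).
Qed.

End poisson_limit.

(** * From convergence of tails to convergence of integrals *)

Section step_approximation.
Context (R : realType) (h : R -> R) (c C eta eps : R).
Hypotheses (eta0 : 0 < eta) (eps0 : 0 <= eps)
  (hL : forall x, x <= c -> h x = 0) (hR : forall x, C <= x -> h x = 0)
  (hunif : forall x y, `|x - y| <= eta -> `|h x - h y| <= eps).

Let t (k : nat) : R := c + k%:R * eta.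

(** The step function that jumps at the points of the grid; its integral against
    any law is a linear combination of tails. *)
Definition step_approx (m : nat) (y : R) : R :=
  \sum_(k < m) (h (t k.+1) - h (t k)) * (t k.+1 < y)%R%:R.

Lemma step_approxP (m : nat) (y : R) : C <= c + m%:R * eta ->
  `|h y - step_approx m y| <= eps * (c < y)%R%:R.
Proof.
move=> Cm; have tS k : t k.+1 = t k + eta by rewrite /t -natr1 mulrDl mul1r addrA.
have [yc|cy] := leP y c.
  rewrite hL// sub0r normrN mulr0 /step_approx big1 ?normr0// => k _.
  have -> : (t k.+1 < y)%R = false; last by rewrite mulr0.
  by apply/negbTE; rewrite -leNgt (le_trans yc)// /t lerDl mulr_ge0// ltW.
rewrite mulr1.
(* Up to the grid point t n, either y has been passed and the error is final,
or all jumps so far are counted and telescope. *)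
have inv n : (y <= t n /\ `|h y - step_approx n y| <= eps) \/
    (t n < y /\ step_approx n y = h (t n)).
  elim: n => [|n [[yt IH]|[ty IH]]].
  - right; rewrite /step_approx big_ord0 /t mul0r addr0; split => //.
    by rewrite hL.
  - left; split; first by rewrite (le_trans yt)// tS lerDl ltW.
    rewrite /step_approx big_ord_recr/= -/(step_approx n y).
    have -> : (t n.+1 < y)%R = false; last by rewrite mulr0 addr0.
    by apply/negbTE; rewrite -leNgt (le_trans yt)// tS lerDl ltW.
  - rewrite /step_approx big_ord_recr/= -/(step_approx n y) IH.
    have [yt|ty'] := leP y (t n.+1).
      left; split => //; rewrite mulr0 addr0; apply: hunif.
      rewrite ger0_norm; last by rewrite subr_ge0 ltW.
      by rewrite lerBlDl -tS.
    by right; split => //; rewrite mulr1 addrC subrK.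
have [[]//|[ty ->]] := inv m.
by rewrite !hR ?subrr ?normr0// (le_trans Cm)// ltW.
Qed.

Context d (T : measurableType d) (mu : {measure set T -> \bar R})
  (D : set T) (Y : T -> R).
Hypotheses (mD : measurable D) (mY : measurable_fun setT Y) (mh : measurable_fun setT h)
  (c0 : (mu (D `&` [set w | c < Y w]%R) < +oo)%E).

Let mlevT x : measurable [set w | x < Y w].
Proof.
have := mY measurableT (measurable_itv `]x, +oo[); congr measurable.
by rewrite setTI; apply/seteqP; split => w /=; rewrite in_itv/= andbT.
Qed.

Let mlev x : measurable (D `&` [set w | x < Y w]).
Proof. exact: measurableI. Qed.

(** The measure is possibly infinite and only its tails on D are finite: in the
    application it is Lebesgue measure on the positive half-line. *)
Definition upper_mass (x : R) : R := fine (mu (D `&` [set w | x < Y w])).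

Let lev_fin x : c <= x -> (mu (D `&` [set w | x < Y w]%R) < +oo)%E.
Proof.
move=> cx; apply: le_lt_trans c0; apply: le_measure; rewrite ?inE//.
by move=> w [Dw]/= xY; split => //=; rewrite (le_lt_trans cx).
Qed.

Let u x w : R := (x < Y w)%R%:R.

Let uE x : u x = \1_[set w | x < Y w].
Proof. by apply/funext => w; rewrite /u indicE; congr (nat_of_bool _)%:R; apply/idP/idP; rewrite inE. Qed.

Let u_int x : c <= x -> mu.-integrable D (EFin \o u x).
Proof.
move=> cx; rewrite uE; apply/integrableP; split.
  by apply/measurable_EFinP/measurable_funTS/measurable_indic.
under eq_integral do rewrite /= ger0_norm//.
by rewrite integral_indic// setIC lev_fin.
Qed.

Let u_val x : \int[mu]_(w in D) u x w = upper_mass x.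
Proof.
by rewrite uE /Rintegral integral_indic// setIC.
Qed.

Lemma step_approx_integral (m : nat) : C <= c + m%:R * eta ->
  mu.-integrable D (EFin \o (h \o Y)) /\
  `|\int[mu]_(w in D) h (Y w) -
    \sum_(k < m) (h (t k.+1) - h (t k)) * upper_mass (t k.+1)| <=
  eps * upper_mass c.
Proof.
move=> Cm.
have ct k : c <= t k by rewrite /t lerDl mulr_ge0// ltW.
have step_int : forall n, mu.-integrable D (EFin \o (step_approx n \o Y)) /\
   \int[mu]_(w in D) step_approx n (Y w) =
   \sum_(k < n) (h (t k.+1) - h (t k)) * upper_mass (t k.+1).
  elim=> [|n [IH1 IH2]].
    have E0 : step_approx 0 \o Y = cst 0.
      by apply/funext => w /=; rewrite /step_approx big_ord0.
    rewrite big_ord0; split.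
      by rewrite E0; exact: integrable0.
    rewrite -[LHS]/(\int[mu]_(w in D) (step_approx 0 \o Y) w) E0.
    by rewrite Rintegral_cst// mul0r.
  have ES w : step_approx n.+1 (Y w) =
      step_approx n (Y w) + (h (t n.+1) - h (t n)) * u (t n.+1) w.
    by rewrite /step_approx big_ord_recr.
  have iu : mu.-integrable D (EFin \o (fun w => (h (t n.+1) - h (t n)) * u (t n.+1) w)).
    have -> : EFin \o (fun w => (h (t n.+1) - h (t n)) * u (t n.+1) w) =
      (fun w => (h (t n.+1) - h (t n))%:E * (EFin \o u (t n.+1)) w)%E.
      by apply/funext => w; rewrite /= EFinM.
    by apply: integrableZl => //; exact: u_int.
  split.
    have -> : EFin \o (step_approx n.+1 \o Y) =
        (EFin \o (step_approx n \o Y)) \+ (EFin \o (fun w => (h (t n.+1) - h (t n)) * u (t n.+1) w)).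
      by apply/funext => w; rewrite /= ES.
    exact: integrableD.
  under eq_Rintegral do rewrite ES.
  rewrite RintegralD// IH2 big_ord_recr/= RintegralZl//; last exact: u_int.
  by rewrite u_val.
have [si <-] := step_int m.
have ie : mu.-integrable D (EFin \o (fun w => eps * u c w)).
  have -> : EFin \o (fun w => eps * u c w) = (fun w => eps%:E * (EFin \o u c) w)%E.
    by apply/funext => w; rewrite /= EFinM.
  by apply: integrableZl => //; exact: u_int.
have mhs : measurable_fun D (EFin \o (fun w => h (Y w) - step_approx m (Y w))).
  have /integrableP[ms _] := si.
  apply/measurable_EFinP; apply: measurable_funB.
    by apply: measurable_funTS; exact: measurableT_comp mh mY.
  exact/measurable_EFinP.
have id : mu.-integrable D (EFin \o (fun w => h (Y w) - step_approx m (Y w))).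
  apply: le_integrable ie => // w Dw /=.
  by rewrite lee_fin (le_trans (step_approxP _ Cm))// ler_norm.
have ih : mu.-integrable D (EFin \o (h \o Y)).
  have -> : EFin \o (h \o Y) = (EFin \o (step_approx m \o Y)) \+
     (EFin \o (fun w => h (Y w) - step_approx m (Y w))).
    by apply/funext => w; rewrite /= -EFinD addrC subrK.
  exact: integrableD.
split => //; rewrite -RintegralB//.
rewrite (le_trans (le_normr_Rintegral _ _))//.
rewrite -u_val -RintegralZl//; last exact: u_int.
apply: le_Rintegral => //.
- exact: (integrable_abse id).
- by move=> w Dw; exact: step_approxP.
Qed.

End step_approximation.

(** A uniformly continuous function with support in [c, C] is approximated by step
    functions, whose integrals involve finitely many tails. The error is at most
    eps times the mass beyond c, which stays bounded. *)
Lemma vague_cvg_tails (R : realType) (h : R -> R) (c C : R)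
    d (T : measurableType d) (mu : {measure set T -> \bar R}) (D : set T) (Y : T -> R)
    d' (T' : measurableType d') (P : probability T' R) (S : nat -> T' -> R)
    (p : nat -> R) :
  (forall x, x <= c -> h x = 0) -> (forall x, C <= x -> h x = 0) ->
  (forall eps, 0 < eps -> exists2 eta, 0 < eta &
    forall x y, `|x - y| <= eta -> `|h x - h y| <= eps) ->
  measurable_fun setT h -> measurable D -> measurable_fun setT Y ->
  (mu (D `&` [set w | c < Y w]%R) < +oo)%E ->
  (forall n, measurable_fun setT (S n)) -> (forall n, 0 <= p n) ->
  (forall x, c <= x -> p n * fine (P [set w | x < S n w]) @[n --> \oo]
     --> upper_mass mu D Y x) ->
  p n * \int[P]_w h (S n w) @[n --> \oo] --> \int[mu]_(w in D) h (Y w).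
Proof.
move=> hL hR hunif mh mD mY muc mS p0 tails.
have umE n x : upper_mass P setT (S n) x = fine (P [set w | x < S n w]).
  by rewrite /upper_mass setTI.
(* An eventual bound for p n times the mass of the law of S n beyond c. *)
pose K := upper_mass mu D Y c + 1.
have um0 : 0 <= upper_mass mu D Y c by exact: fine_ge0.
have K0 : 0 < K by rewrite /K ltr_wpDl.
apply/cvgrPdist_le => e e0.
have e3K : 0 < e / 3 / K by rewrite !divr_gt0.
have [eta eta0 hun] := hunif _ e3K.
have [m Cm] : exists m : nat, C <= c + m%:R * eta.
  exists (Num.truncn (`|C - c| / eta)).+1.
  rewrite -lerBlDl -ler_pdivrMr//.
  by rewrite (le_trans _ (ltW (truncnS_gt _)))// ler_pM2r ?invr_gt0// ler_norm.
pose t (k : nat) : R := c + k%:R * eta.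
have e3K0 := ltW e3K.
have [_ limA] := step_approx_integral eta0 e3K0 hL hR hun mD mY mh muc Cm.
have nA n : `|p n * \int[P]_w h (S n w) -
    \sum_(k < m) (h (t k.+1) - h (t k)) * (p n * fine (P [set w | t k.+1 < S n w]%R))| <=
    e / 3 / K * (p n * fine (P [set w | c < S n w]%R)).
  have Pc : (P (setT `&` [set w | c < S n w]%R) < +oo)%E.
    rewrite setTI (le_lt_trans (probability_le1 _ _)) ?ltry//.
    have := mS n measurableT _ (measurable_itv `]c, +oo[); congr measurable.
    by rewrite setTI; apply/seteqP; split => w /=; rewrite in_itv/= andbT.
  have [_] := step_approx_integral eta0 e3K0 hL hR hun measurableT (mS n) mh Pc Cm.
  rewrite umE => A.
  rewrite [X in _ - X](_ : _ = p n * \sum_(k < m)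
      (h (t k.+1) - h (t k)) * upper_mass P setT (S n) (t k.+1)); last first.
    by rewrite mulr_sumr; apply: eq_bigr => k _; rewrite umE mulrCA.
  by rewrite -mulrBr normrM (ger0_norm (p0 n)) mulrCA ler_wpM2l.
have sumcvg : \sum_(k < m) (h (t k.+1) - h (t k)) *
      (p n * fine (P [set w | t k.+1 < S n w]%R)) @[n --> \oo] -->
    \sum_(k < m) (h (t k.+1) - h (t k)) * upper_mass mu D Y (t k.+1).
  apply: cvg_big => [|k _]; [exact: add_continuous|apply: cvgM]; first exact: cvg_cst.
  by apply: tails; rewrite /t lerDl mulr_ge0// ltW.
have e30 : 0 < e / 3 by rewrite divr_gt0.
near=> n.
have B1 : e / 3 / K * (p n * fine (P [set w | c < S n w]%R)) <= e / 3.
  rewrite -mulrA ler_piMr ?(ltW e30)// mulrC ler_pdivrMr// mul1r.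
  near: n; move/cvgrPdist_le : (tails c (lexx _)) => /(_ 1 ltr01).
  apply: filterS => n; rewrite ler_norml => /andP[+ _].
  by rewrite /K; lra.
have B2 : e / 3 / K * upper_mass mu D Y c <= e / 3.
  rewrite -mulrA ler_piMr ?(ltW e30)// mulrC ler_pdivrMr// mul1r /K.
  by rewrite lerDl.
have B3 : `|\sum_(k < m) (h (t k.+1) - h (t k)) * upper_mass mu D Y (t k.+1) -
   \sum_(k < m) (h (t k.+1) - h (t k)) *
      (p n * fine (P [set w | t k.+1 < S n w]%R))| <= e / 3.
  by near: n; move/cvgrPdist_le : sumcvg; apply.
pose I := \int[mu]_(w in D) h (Y w); pose J := p n * \int[P]_w h (S n w).
pose s1 := \sum_(k < m) (h (t k.+1) - h (t k)) * upper_mass mu D Y (t k.+1).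
pose s2 := \sum_(k < m) (h (t k.+1) - h (t k)) *
      (p n * fine (P [set w | t k.+1 < S n w]%R)).
have h1 : `|I - s1| <= e / 3 / K * upper_mass mu D Y c := limA.
have h2 : `|J - s2| <= _ := nA n.
have h3 : `|s1 - s2| <= e / 3 := B3.
rewrite -/I -/J.
have -> : I - J = (I - s1) + (s1 - s2) + (s2 - J) by ring.
rewrite (le_trans (ler_normD _ _))// (_ : e = e / 3 + e / 3 + e / 3); last by field.
apply: lerD; last by rewrite distrC (le_trans h2).
rewrite (le_trans (ler_normD _ _))//; apply: lerD => //.
exact: le_trans h1 _.
Unshelve. all: by end_near. Qed.

(** * Regularly varying tails and their norming sequences *)

Lemma ltr_pow2R (R : realType) (x y : R) : x < y -> 2 `^ x < 2 `^ y.
Proof.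
move=> xy; rewrite /powR pnatr_eq0/= ltr_expR ltr_pM2r//.
by rewrite ln_gt0// ltr1n.
Qed.

Section regular_variation.
Context (R : realType) (G : R -> R) (alpha : R) (a : nat -> R).
Hypotheses (Gmono : forall x y, x <= y -> G y <= G x) (G0 : forall x, 0 <= G x)
  (Gy : G x @[x --> +oo] --> 0) (alpha0 : 0 < alpha)
  (ha : forall x, 0 < x -> n%:R * G (a n * x) @[n --> \oo] --> x `^ (- alpha)).

Lemma tail_vanish x : 0 < x -> G (a n * x) @[n --> \oo] --> (0 : R).
Proof.
move=> x0.
  rewrite -(cvg_shiftS (fun n => G (a n * x))).
  have /= h1 := ha x0; rewrite -(cvg_shiftS (fun n => n%:R * G (a n * x))) /= in h1.
  have h2 : (n.+1%:R^-1 : R) @[n --> \oo] --> (0 : R) by exact: cvg_harmonic.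
  rewrite (_ : (fun n => G (a n.+1 * x)) =
      (fun n => n.+1%:R^-1 * (n.+1%:R * G (a n.+1 * x)))).
    by have h3 := cvgM h2 h1; rewrite mul0r in h3; exact: h3.
  by apply/funext => n; rewrite mulrA mulVf ?mul1r.
Qed.

Lemma cvg_tailS x : 0 < x -> n.+1%:R * G (a n * x) @[n --> \oo] --> x `^ (- alpha).
Proof.
move=> x0; have G0' := tail_vanish x0.
have -> : (fun n => n.+1%:R * G (a n * x)) =
    (fun n => n%:R * G (a n * x) + G (a n * x)).
  by apply/funext => n; rewrite -natr1 mulrDl mul1r.
by rewrite -[X in _ --> X]addr0; apply: cvgD; [exact: ha|exact: G0'].
Qed.

(** If a n <= 0 then 2 a n <= a n, and monotonicity of G contradicts the strict
    inequality between the limits at 1 and 2. *)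
Lemma norming_gt0 : \forall n \near \oo, 0 < a n.
Proof.
have lt21 : 2 `^ (- alpha) < (1 : R) `^ (- alpha).
  by rewrite powR1 -[ltRHS](powRr0 2) ltr_pow2R// oppr_lt0.
have [m m1 m2] : exists2 m, 2 `^ (- alpha) < m & m < (1 : R) `^ (- alpha).
  by exists (((2 `^ (- alpha) + 1 `^ (- alpha)) / 2)); [rewrite midf_lt|rewrite midf_lt].
near=> n; rewrite ltNge; apply/negP => an0.
have h1 : m < n%:R * G (a n * 1) by near: n; exact: cvgr_gt (ha ltr01) _ m2.
have h2 : n%:R * G (a n * 2) < m by near: n; exact: cvgr_lt (ha (ltr0Sn _ 1)) _ m1.
have : n%:R * G (a n * 1) <= n%:R * G (a n * 2).
  by rewrite ler_wpM2l//; apply: Gmono; lra.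
by rewrite leNgt (lt_trans h2).
Unshelve. all: by end_near. Qed.

(** If G vanished beyond y then every a n x would eventually be below y, so for
    a suitable x the values G (a n x) would stay above some G y1 > 0, against
    tail_vanish. *)
Lemma tail_gt0 y : 0 < G y.
Proof.
rewrite lt_neqAle G0 andbT; apply/negP => /eqP Gy0.
have tail0 z : y <= z -> G z = 0.
  by move=> yz; apply/eqP; rewrite eq_le G0 andbT [X in _ <= X]Gy0 Gmono.
have pos x : 0 < x -> \forall n \near \oo, a n * x < y.
  move=> x0; near=> n.
  have h : 0 < n%:R * G (a n * x).
    by near: n; exact: cvgr_gt (ha x0) _ (powR_gt0 (- alpha) x0).
  rewrite ltNge; apply/negP => ay.
  by rewrite tail0// mulr0 ltxx in h.
have [n0 [an0 an1]] : exists n, 0 < a n /\ a n * 1 < y.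
  near \oo => n; exists n; split; first by near: n; exact: norming_gt0.
  by near: n; exact: pos.
have y0 : 0 < y by rewrite (lt_trans an0)// -[a n0]mulr1.
have [y1 [y10 Gy1]] : exists y1, 0 < y1 /\ 0 < G y1.
  near \oo => n; exists (a n * 1); split.
    by rewrite mulr1; near: n; exact: norming_gt0.
  have : 0 < n%:R * G (a n * 1).
    by near: n; exact: cvgr_gt (ha ltr01) _ (powR_gt0 (- alpha) ltr01).
  move=> h; rewrite lt_neqAle G0 andbT; apply/eqP => h0.
  by rewrite -h0 mulr0 ltxx in h.
(* From a n < y follows a n (y1 / y) < y1, while tail_vanish forces
a n (y1 / y) beyond y1. *)
have c0 : 0 < y1 / y by rewrite divr_gt0.
have [n [n1 n2]] : exists n, a n * 1 < y /\ G (a n * (y1 / y)) < G y1.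
  near \oo => n; exists n; split; first by near: n; exact: pos.
  by near: n; exact: cvgr_lt (tail_vanish c0) _ Gy1.
have : y1 < a n * (y1 / y).
  by rewrite ltNge; apply/negP => /Gmono; rewrite leNgt n2.
rewrite mulrCA -[ltLHS]mulr1 ltr_pM2l// ltr_pdivlMr// mul1r.
by rewrite mulr1 in n1; rewrite ltNge ltW.
Unshelve. all: by end_near. Qed.

(** The integer part n of 1 / G y: it interpolates between the norming sequence,
    indexed by integers, and arbitrary large levels y. *)
Lemma tail_index (N : nat) : \forall y \near +oo,
  exists n, [/\ (N <= n)%N, n%:R * G y <= 1 & 1 < n.+1%:R * G y].
Proof.
have N0 : 0 < N.+1%:R^-1 :> R by rewrite invr_gt0.
move/cvgrPdist_le : Gy => /(_ _ N0); apply: filterS => y.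
rewrite sub0r normrN ger0_norm// => Gy'.
have y0 := tail_gt0 y.
exists (Num.truncn (G y)^-1).
have Gi : 0 <= (G y)^-1 by rewrite invr_ge0.
have /andP[t1 t2] := truncn_itv Gi.
split.
- rewrite -ltnS -(ltr_nat R) (le_lt_trans _ t2)//.
  rewrite (@le_trans _ _ N.+1%:R) ?ler_nat//.
  by rewrite -[leLHS]invrK lef_pV2 ?posrE.
- by rewrite -ler_pdivlMr// div1r.
- by rewrite -ltr_pdivrMr// div1r.
Qed.

(** Let n be about 1 / G y. Then y lies above a n 2^(-e), because n G there tends
    to 2^(e alpha) > 1, so 2 y lies above a n 2^(1-e), where n G tends to
    2^(-alpha + e alpha) < 2^(-r). *)
Lemma tail_double_le (r : R) : r < alpha ->
  \forall y \near +oo, G (2 * y) <= 2 `^ (- r) * G y.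
Proof.
(* Half of the room between alpha and r, as a fraction of alpha. *)
move=> ra; pose e := (alpha - r) / (2 * alpha).
have e0 : 0 < e by rewrite divr_gt0 ?subr_gt0// mulr_gt0.
have u0 : 0 < 2 `^ (- e) :> R by rewrite powR_gt0.
have v0 : 0 < 2 `^ (1 - e) :> R by rewrite powR_gt0.
have l1 : 1 < (2 `^ (- e)) `^ (- alpha).
  by rewrite -powRrM mulrNN -[ltLHS](powRr0 2) ltr_pow2R// mulr_gt0.
have l2 : (2 `^ (1 - e)) `^ (- alpha) < 2 `^ (- r).
  rewrite -powRrM ltr_pow2R//.
  rewrite (_ : (1 - e) * - alpha = - alpha + (alpha - r) / 2); first by lra.
  by rewrite /e; field; rewrite gt_eqF.
have [N _ HN] : \forall n \near \oo, [/\ 0 < a n,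
    1 < n%:R * G (a n * 2 `^ (- e)) & n.+1%:R * G (a n * 2 `^ (1 - e)) < 2 `^ (- r)].
  near=> n; split; near: n; first exact: norming_gt0.
    exact: cvgr_gt (ha u0) _ l1.
  exact: cvgr_lt (cvg_tailS v0) _ l2.
have := tail_index N; apply: filterS => y [n [Nn n1 n2]].
have [an0 h1 h2] := HN n Nn.
have lty : a n * 2 `^ (- e) < y.
  rewrite ltNge; apply/negP => /Gmono; rewrite leNgt => /negP; apply.
  by rewrite -(@ltr_pM2l _ n%:R) ?(le_lt_trans n1)//;
   case: n {Nn n2 h2 an0} n1 h1 => // _; rewrite mul0r => /lt_trans/(_ ltr01); rewrite ltxx.
have : G (2 * y) <= G (a n * 2 `^ (1 - e)).
  apply: Gmono; rewrite powRD ?pnatr_eq0 ?implybT// powRr1// mulrCA.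
  by rewrite ler_pM2l// ltW.
move/le_trans; apply.
rewrite -(@ler_pM2l _ n.+1%:R)// (le_trans (ltW h2))// mulrCA ler_peMr ?powR_ge0//.
exact: ltW.
Unshelve. all: by end_near. Qed.

Lemma tail_double_ge (s : R) : alpha < s ->
  \forall y \near +oo, 2 `^ (- s) * G y <= G (2 * y).
Proof.
(* Half of the room between s and alpha, as a fraction of alpha. *)
move=> sa; pose e := (s - alpha) / (2 * alpha).
have e0 : 0 < e by rewrite divr_gt0 ?subr_gt0// mulr_gt0.
have u0 : 0 < 2 `^ e :> R by rewrite powR_gt0.
have v0 : 0 < 2 `^ (1 + e) :> R by rewrite powR_gt0.
have l1 : (2 `^ e) `^ (- alpha) < 1.
  by rewrite -powRrM mulrN -[ltRHS](powRr0 2) ltr_pow2R// oppr_lt0 mulr_gt0.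
have l2 : 2 `^ (- s) < (2 `^ (1 + e)) `^ (- alpha).
  rewrite -powRrM ltr_pow2R//.
  rewrite (_ : (1 + e) * - alpha = - alpha - (s - alpha) / 2); first by lra.
  by rewrite /e; field; rewrite gt_eqF.
have [N _ HN] : \forall n \near \oo, [/\ 0 < a n,
    n.+1%:R * G (a n * 2 `^ e) < 1 & 2 `^ (- s) < n%:R * G (a n * 2 `^ (1 + e))].
  near=> n; split; near: n; first exact: norming_gt0.
    exact: cvgr_lt (cvg_tailS u0) _ l1.
  exact: cvgr_gt (ha v0) _ l2.
have := tail_index N.+1; apply: filterS => y [n [Nn n1 n2]].
have [an0 h1 h2] := HN n (ltnW Nn).
have n0 : (0 < n)%N by exact: leq_ltn_trans Nn.
have lty : y < a n * 2 `^ e.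
  rewrite ltNge; apply/negP => /Gmono; rewrite leNgt => /negP; apply.
  by rewrite -(@ltr_pM2l _ n.+1%:R) ?(lt_trans h1).
have : G (a n * 2 `^ (1 + e)) <= G (2 * y).
  apply: Gmono; rewrite powRD ?pnatr_eq0 ?implybT// powRr1// mulrCA.
  by rewrite ler_pM2l// ltW.
apply: le_trans.
rewrite -(@ler_pM2l _ n%:R) ?ltr0n// (le_trans _ (ltW h2))// mulrCA.
by rewrite ler_piMr ?powR_ge0.
Unshelve. all: by end_near. Qed.

(** Iterated doubling gives the Potter bounds along a dyadic sequence, from
    which monotonicity of G controls all large levels. *)
Lemma tail_dyadic_le (r : R) : r < alpha ->
  exists2 y0, 0 < y0 & forall k, G (2 ^+ k * y0) <= (2 `^ (- r)) ^+ k * G y0.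
Proof.
move=> /tail_double_le [M [_ HM]].
exists (Num.max 1 (M + 1)); first by rewrite lt_max ltr01.
elim=> [|k IH]; first by rewrite !expr0 !mul1r.
rewrite exprS -mulrA (le_trans (HM _ _))//.
  have y1 : 1 <= Num.max 1 (M + 1) by rewrite le_max lexx.
  have My : M < Num.max 1 (M + 1) by rewrite lt_max ltrDl ltr01 orbT.
  rewrite (lt_le_trans My)// ler_peMl ?(le_trans ler01)//.
  by rewrite exprn_ege1// ler1n.
by rewrite exprS -mulrA ler_pM2l ?powR_gt0.
Qed.

Lemma tail_dyadic_ge (s : R) : alpha < s ->
  exists2 y0, 0 < y0 & forall k, (2 `^ (- s)) ^+ k * G y0 <= G (2 ^+ k * y0).
Proof.
move=> /tail_double_ge [M [_ HM]].
exists (Num.max 1 (M + 1)); first by rewrite lt_max ltr01.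
elim=> [|k IH]; first by rewrite !expr0 !mul1r.
rewrite exprS -mulrA [2 ^+ k.+1]exprS -mulrA (le_trans _ (HM _ _))//.
  by rewrite ler_pM2l ?powR_gt0.
have y1 : 1 <= Num.max 1 (M + 1) by rewrite le_max lexx.
have My : M < Num.max 1 (M + 1) by rewrite lt_max ltrDl ltr01 orbT.
rewrite (lt_le_trans My)// ler_peMl ?(le_trans ler01)//.
by rewrite exprn_ege1// ler1n.
Qed.

(** G (a n) tends to 0, and G is bounded away from 0 to the left of any y. *)
Lemma norming_large y : \forall n \near \oo, y < a n.
Proof.
near=> n; rewrite ltNge; apply/negP => any.
have Gn : G (a n * 1) < G y.
  by near: n; exact: cvgr_lt (tail_vanish ltr01) _ (tail_gt0 y).
by move: Gn; rewrite ltNge mulr1 Gmono.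
Unshelve. all: by end_near. Qed.

(** By the dyadic lower bound, G (a m) is at least a constant times a m ^ (- s),
    and m G (a m) is bounded. *)
Lemma norming_lower (s : R) : alpha < s ->
  exists2 c, 0 < c & \forall m \near \oo, c * m%:R <= a m `^ s.
Proof.
move=> sa; have s0 : 0 < s by exact: lt_trans sa.
have [y0 y00 Hy0] := tail_dyadic_ge sa.
have qs k : (2 ^+ k) `^ s * (2 `^ (- s)) ^+ k = 1 :> R.
  rewrite -[2 ^+ k]powR_mulrn// -[X in _ * X]powR_mulrn ?powR_ge0//.
  rewrite -!powRrM -powRD ?pnatr_eq0 ?implybT//.
  by rewrite mulNr mulrC subrr powRr0.
pose c := G y0 * (2 `^ (- s)) * y0 `^ s / 2.
exists c.
  by rewrite /c !mulr_gt0 ?powR_gt0 ?invr_gt0 ?tail_gt0.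
near=> m.
have am0 : 0 < a m by near: m; exact: norming_gt0.
have amy : y0 < a m by near: m; exact: norming_large.
have mG : m%:R * G (a m * 1) < 2.
  by near: m; apply: cvgr_lt (ha ltr01) _ _; rewrite powR1 ltr1n.
have exk : exists k, a m < 2 ^+ k * y0.
  exists (Num.truncn (a m / y0)).+1; rewrite -ltr_pdivrMr//.
  rewrite (lt_le_trans (truncnS_gt _))// -natrX ler_nat.
  by rewrite ltnW// ltn_expl.
(* The dyadic level just above a m. *)
have /ex_minnP[[|k] kP kmin] := exk.
  by rewrite expr0 mul1r ltNge (ltW amy) in kP.
have amk : 2 ^+ k * y0 <= a m.
  by rewrite leNgt; apply/negP => /kmin; rewrite ltnn.
have Gk : (2 `^ (- s)) ^+ k.+1 * G y0 <= G (a m).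
  by apply: (le_trans (Hy0 k.+1)); apply: Gmono; exact: ltW.
have ys : (2 ^+ k * y0) `^ s <= a m `^ s.
  by apply: ge0_ler_powR; rewrite ?nnegrE ?(ltW s0)// ?mulr_ge0 ?ltW// exprn_gt0.
apply: le_trans ys; rewrite powRM ?exprn_ge0// ?(ltW y00)//.
rewrite -(@ler_pM2r _ ((2 `^ (- s)) ^+ k)); last by rewrite exprn_gt0 ?powR_gt0.
rewrite [leRHS]mulrAC qs mul1r.
have : m%:R * ((2 `^ (- s)) ^+ k.+1 * G y0) <= 2.
  by apply: le_trans (ltW mG); rewrite mulr1 ler_wpM2l.
rewrite exprS => h.
have -> : c * m%:R * (2 `^ (- s)) ^+ k =
   (m%:R * (2 `^ (- s) * (2 `^ (- s)) ^+ k * G y0) / 2) * y0 `^ s.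
  by rewrite /c; field.
rewrite ger_pMl ?powR_gt0//; lra.
Unshelve. all: by end_near. Qed.

End regular_variation.

(** * Moments of order below the tail index *)

Lemma dyadic_between (R : realType) (y0 y : R) : 0 < y0 -> y0 < y ->
  exists k : nat, 2 ^+ k * y0 < y /\ y <= 2 ^+ k.+1 * y0.
Proof.
move=> y00 y0y.
have exk : exists k, y <= 2 ^+ k * y0.
  exists (Num.truncn (y / y0)).+1; rewrite -ler_pdivrMr//.
  rewrite (le_trans (ltW (truncnS_gt _)))// -natrX ler_nat.
  by rewrite ltnW// ltn_expl.
have /ex_minnP[[|k] kP kmin] := exk.
  by move: kP; rewrite expr0 mul1r leNgt y0y.
exists k; split => //.
by rewrite ltNge; apply/negP => /kmin; rewrite ltnn.
Qed.

(** Cut the range of |f| into dyadic shells: the shell above 2^k y0 contributes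
    at most a constant times (2^r q)^k, and the geometric series converges. *)
Lemma moment_finite (R : realType) d (T : measurableType d) (P : probability T R)
    (f : T -> R) (y0 q g r : R) :
  measurable_fun setT f -> 0 < y0 -> 0 <= q -> 0 <= g -> 0 < r -> 2 `^ r * q < 1 ->
  (forall k, (P [set w | 2 ^+ k * y0 < `|f w|]%R <= (q ^+ k * g)%:E)%E) ->
  exists2 K, 0 <= K & (\int[P]_w (`|f w| `^ r)%:E <= K%:E)%E.
Proof.
move=> mf y00 q0 g0 r0 z1 tails.
pose z := 2 `^ r * q.
have z0 : 0 <= z by rewrite mulr_ge0 ?powR_ge0.
pose B k w : \bar R := ((2 ^+ k.+1 * y0) `^ r * \1_[set w | 2 ^+ k * y0 < `|f w|]%R w)%:E.
have mlev x : measurable [set w | x < `|f w|].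
  have mnf : measurable_fun setT (fun w => `|f w|) by exact: measurableT_comp.
  have := mnf measurableT _ (measurable_itv `]x, +oo[); congr measurable.
  by rewrite setTI; apply/seteqP; split => w /=; rewrite in_itv/= andbT.
have B0 k w : (0 <= B k w)%E by rewrite lee_fin mulr_ge0 ?powR_ge0.
have mB k : measurable_fun setT (B k).
  by apply/measurable_EFinP; apply: measurable_funM => //; exact: measurable_indic.
have pw w : ((`|f w| `^ r)%:E <= (y0 `^ r)%:E + \sum_(k <oo) B k w)%E.
  have [fy|yf] := leP `|f w| y0.
    rewrite -[leLHS]adde0; apply: leeD.
      by rewrite lee_fin; apply: ge0_ler_powR; rewrite ?nnegrE// ltW.
    exact: nneseries_ge0.
  have [k [k1 k2]] := dyadic_between y00 yf.
  rewrite -[leLHS]add0e; apply: leeD; first by rewrite lee_fin powR_ge0.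
  apply: (@le_trans _ _ (B k w)).
    rewrite /B indicE mem_set//= mulr1 lee_fin.
    apply: ge0_ler_powR; rewrite ?nnegrE ?(ltW r0)//.
    by rewrite mulr_ge0 ?exprn_ge0// ltW.
  apply: le_trans (nneseries_lim_ge k.+1 _) => //.
  by rewrite big_nat_recr//= leeDr// sume_ge0.
pose c := (2 * y0) `^ r * g.
have c0 : 0 <= c by rewrite mulr_ge0 ?powR_ge0.
have IB k : (\int[P]_w B k w <= (c * z ^+ k)%:E)%E.
  rewrite /B; under eq_integral do rewrite EFinM.
  rewrite ge0_integralZl_EFin ?powR_ge0//; last first.
    by apply/measurable_EFinP; exact: measurable_indic.
  rewrite integral_indic// setIT.
  apply: (@le_trans _ _ (((2 ^+ k.+1 * y0) `^ r)%:E * (q ^+ k * g)%:E)%E).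
    by apply: lee_wpmul2l; [rewrite lee_fin powR_ge0|exact: tails].
  rewrite -EFinM lee_fin /c /z.
  have -> : 2 ^+ k.+1 * y0 = (2 * y0) * 2 ^+ k :> R by rewrite exprS mulrAC.
  rewrite (powRM r (_ : 0 <= 2 * y0)) ?mulr_ge0 ?exprn_ge0 ?(ltW y00)//.
  have -> : (2 ^+ k) `^ r = (2 `^ r) ^+ k :> R.
    by rewrite -powR_mulrn// -powRrM mulrC powRrM powR_mulrn ?powR_ge0.
  rewrite exprMn le_eqVlt; apply/orP; left; apply/eqP; ring.
exists (y0 `^ r + c / (1 - z)).
  by rewrite addr_ge0 ?powR_ge0// divr_ge0// subr_ge0 ltW.
apply: (@le_trans _ _ (\int[P]_w ((y0 `^ r)%:E + \sum_(k <oo) B k w))%E).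
  apply: ge0_le_integral => //.
  - apply/measurable_EFinP.
    by apply: (measurableT_comp (measurable_powR r)); exact: measurableT_comp.
  - apply: emeasurable_funD => //.
    by apply: ge0_emeasurable_sum.
rewrite ge0_integralD//; last 3 first.
- by move=> w _; rewrite lee_fin powR_ge0.
- by move=> w _; exact: nneseries_ge0.
- exact: ge0_emeasurable_sum.
rewrite integral_cst//= probability_setT mule1 EFinD leeD2l//.
rewrite integral_nneseries//.
apply: lime_le; first by apply: is_cvg_nneseries => k _ _; exact: integral_ge0.
apply: nearW => n.
rewrite (le_trans (lee_sum _ (fun k _ => IB k)))// sumEFin lee_fin.
have zn1 : z != 1 by rewrite lt_eqF.
have := @geometric_seriesE R c z zn1 => /(congr1 (fun u => u n)).
rewrite /series/= /geometric/= => ->.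
rewrite ler_wpM2r ?invr_ge0 ?subr_ge0 ?(ltW z1)//.
by rewrite ler_piMr// gerBl exprn_ge0.
Qed.

(** * The total mass off the diagonal *)

(** For r <= 1 this is the subadditivity of the power, for r > 1 the power mean
    inequality, proved from Young's inequality at the mean value of x. *)
Lemma power_mean_le (R : realType) (I : finType) (x : I -> R) (r : R) :
  0 < r -> (forall i, 0 <= x i) ->
  (\sum_i x i) `^ r <= #|I|%:R `^ (Num.max r 1 - 1) * \sum_i x i `^ r.
Proof.
move=> r0 x0; set S := \sum_i x i.
have S0 : 0 <= S by exact: sumr_ge0.
have [->|Sn0] := eqVneq S 0.
  rewrite powR0 ?gt_eqF// mulr_ge0 ?powR_ge0// sumr_ge0// => i _.
  exact: powR_ge0.
have Sp : 0 < S by rewrite lt_neqAle eq_sym Sn0.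
have [r1|r1] := leP r 1.
  rewrite subrr powRr0 mul1r.
  have term i : S `^ r * (x i / S) <= x i `^ r.
    have xS : x i / S <= 1.
      by rewrite ler_pdivrMr// mul1r /S (bigD1 i)//= lerDl sumr_ge0.
    have xS0 : 0 <= x i / S by rewrite divr_ge0.
    have le1 : x i / S <= (x i / S) `^ r.
      have [->|xn0] := eqVneq (x i / S) 0; first exact: powR_ge0.
      rewrite -[leLHS]powRr1//; apply: ger_powR => //.
      by rewrite lt_neqAle eq_sym xn0 xS0 xS.
    rewrite -[in leRHS](divfK Sn0 (x i)) powRM// mulrC.
    by rewrite ler_wpM2r// powR_ge0.
  have -> : S `^ r = \sum_i S `^ r * (x i / S).
    by rewrite -mulr_sumr -mulr_suml divff// mulr1.
  exact: ler_sum.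
set N : R := #|I|%:R.
have N0 : 0 < N.
  rewrite ltr0n; apply/card_gt0P.
  have /existsP[i _] : [exists i : I, true].
    apply: contraT => /existsPn no; exfalso; move/eqP: Sn0; apply.
    by rewrite /S big1// => i; have := no i.
  by exists i.
pose s := S / N; have s0 : 0 < s by rewrite divr_gt0.
have r1' : 0 < r - 1 by rewrite subr_gt0.
have term i : r * (x i * s `^ (r - 1)) <= x i `^ r + (r - 1) * s `^ r.
  have rr : 0 < r / (r - 1) by rewrite divr_gt0.
  have rn0 : r != 0 by rewrite gt_eqF.
  have rn1 : r - 1 != 0 by rewrite gt_eqF.
  have pq : r^-1 + (r / (r - 1))^-1 = 1 by field; rewrite rn0 rn1.
  (* Young's inequality for x i and s ^ (r - 1), with the conjugate exponents r
  and r / (r - 1). *)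
  have := conjugate_powR (x0 i) (powR_ge0 s (r - 1)) r0 rr pq.
  rewrite -powRrM (_ : (r - 1) * (r / (r - 1)) = r); last by field.
  rewrite -(ler_pM2l r0) => /le_trans; apply.
  rewrite le_eqVlt; apply/orP; left; apply/eqP; field.
  by rewrite rn0 rn1.
have sumle : r * (N * s `^ r) <= \sum_i x i `^ r + N * ((r - 1) * s `^ r).
  have -> : r * (N * s `^ r) = \sum_i r * (x i * s `^ (r - 1)).
    rewrite -mulr_sumr -mulr_suml -/S; congr (_ * _).
    have -> : S = N * s by rewrite /s mulrC divfK// gt_eqF.
    rewrite -mulrA; congr (_ * _).
    rewrite -[X in _ = X * _]powRr1 ?(ltW s0)// -powRD; last by rewrite (gt_eqF s0) implybT.
    by rewrite addrC subrK.
  apply: (le_trans (ler_sum _ (fun i _ => term i))).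
  by rewrite big_split/= sumr_const /N mulr_natl; exact: lexx.
have -> : S `^ r = N `^ (r - 1) * (N * s `^ r).
  have {1}-> : S = N * s by rewrite /s mulrC divfK// gt_eqF.
  rewrite powRM ?(ltW N0) ?(ltW s0)// mulrA; congr (_ * _).
  rewrite -[X in _ = _ * X]powRr1 ?(ltW N0)// -powRD; last by rewrite (gt_eqF N0) implybT.
  by rewrite subrK.
by rewrite ler_wpM2l ?powR_ge0//; lra.
Qed.

(** A quantity that is at least 1 when some off-diagonal absolute row sum of the
    Gram matrix of the rows of x exceeds A, and whose expectation factorises
    over the two rows of each entry: Markov's inequality of order r, in a
    pointwise form. The power of p n is the constant of power_mean_le for the
    p n terms of a row sum. *)
Definition overflow (R : realType) (p n : nat) (r A : R) (x : 'I_p -> 'I_n -> R) : R :=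
  A `^ (- r) * (p * n)%:R `^ (Num.max r 1 - 1) *
  \sum_i \sum_(j | j != i) \sum_t `|x i t| `^ r * `|x j t| `^ r.

Lemma overflow_ge0 (R : realType) p n (r A : R) (x : 'I_p -> 'I_n -> R) :
  0 <= overflow r A x.
Proof.
rewrite /overflow mulr_ge0 ?mulr_ge0 ?powR_ge0//.
apply: sumr_ge0 => i _; apply: sumr_ge0 => j _; apply: sumr_ge0 => t _.
by rewrite mulr_ge0 ?powR_ge0.
Qed.

Lemma overflow_ge1 (R : realType) p n (r A : R) (x : 'I_p -> 'I_n -> R) (i : 'I_p) :
  0 < r -> 0 < A -> A < \sum_(j | j != i) `|\sum_t x i t * x j t| ->
  1 <= overflow r A x.
Proof.
move=> r0 A0 Ai.
(* The row sum as a sum over all p n pairs, the diagonal ones contributing 0. *)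
pose z (jt : 'I_p * 'I_n) : R := if jt.1 != i then `|x i jt.2| * `|x jt.1 jt.2| else 0.
have z0 jt : 0 <= z jt by rewrite /z; case: ifP => // _; rewrite mulr_ge0.
have Az : A <= \sum_jt z jt.
  apply: (le_trans (ltW Ai)).
  rewrite -(pair_bigA _ (fun j t => z (j, t)))/= [leLHS]big_mkcond/=.
  apply: ler_sum => j _; rewrite /z/=; case: ifP => // ji; last by rewrite sumr_ge0.
  rewrite (le_trans (ler_norm_sum _ _ _))//.
  by apply: ler_sum => t _; rewrite normrM.
have h1 : A `^ r <= (p * n)%:R `^ (Num.max r 1 - 1) * \sum_jt z jt `^ r.
  apply: le_trans (_ : (\sum_jt z jt) `^ r <= _).
    apply: ge0_ler_powR; rewrite ?nnegrE ?(ltW r0) ?(ltW A0)//.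
    exact: sumr_ge0.
  by apply: (le_trans (power_mean_le r0 z0)); rewrite card_prod !card_ord.
have h2 : \sum_jt z jt `^ r <=
    \sum_i \sum_(j | j != i) \sum_t `|x i t| `^ r * `|x j t| `^ r.
  rewrite -(pair_bigA _ (fun j t => z (j, t) `^ r))/= [leRHS](bigD1 i)//=.
  rewrite -[leLHS]addr0 lerD//; last first.
    apply: sumr_ge0 => k _; apply: sumr_ge0 => j _; apply: sumr_ge0 => t _.
    by rewrite mulr_ge0 ?powR_ge0.
  rewrite [leRHS]big_mkcond/=; apply: ler_sum => j _; rewrite /z/=.
  case: ifP => ji.
    by apply: ler_sum => t _; rewrite powRM.
  by rewrite big1// => t _; rewrite powR0// gt_eqF.
rewrite /overflow -mulrA powRN mulrC ler_pdivlMr ?powR_gt0// mul1r.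
by apply: (le_trans h1); rewrite ler_wpM2l ?powR_ge0.
Qed.

Lemma integral_sum_le (R : realType) d (T : measurableType d)
    (P : probability T R) (I : finType) (S : pred I) (f : I -> T -> R) (c : I -> R) :
  (forall i, measurable_fun setT (f i)) -> (forall i w, 0 <= f i w) ->
  (forall i, S i -> (\int[P]_w (f i w)%:E <= (c i)%:E)%E) ->
  (\int[P]_w (\sum_(i | S i) f i w)%:E <= (\sum_(i | S i) c i)%:E)%E.
Proof.
move=> mf f0 fc; under eq_integral do rewrite -sumEFin big_mkcond/=.
rewrite ge0_integral_sum//; last 2 first.
- by move=> i; case: (S i) => //; exact/measurable_EFinP.
- by move=> i w _; case: (S i) => //; rewrite lee_fin.
rewrite -sumEFin [leRHS]big_mkcond/=; apply: lee_sum => i _.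
case: ifPn => [/fc//|_].
by rewrite integral0.
Qed.

Section overflow_expectation.
Context (R : realType) d (T : measurableType d) (P : probability T R) (p n : nat)
  (X : 'I_p -> 'I_n -> {RV P >-> R}).
Hypothesis hX : mutually_independent P (fun i w => [tuple X i t w | t < n]).

Lemma measurable_overflow r A :
  measurable_fun setT (fun w => overflow r A (fun i t => X i t w)).
Proof.
rewrite /overflow; apply: measurable_funM => //.
apply: measurable_sum => i; under eq_fun do rewrite big_mkcond.
apply: measurable_sum => j; case: (j != i) => //; apply: measurable_sum => t.
have m k : measurable_fun setT (fun w => `|X k t w| `^ r).
  apply: (measurableT_comp (measurable_powR r)).
  by apply: measurableT_comp => //; exact: measurable_funPT.
by apply: measurable_funM.
Qed.

Lemma integral_overflow_le (r A K : R) :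
  (forall i t, (\int[P]_w (`|X i t w| `^ r)%:E <= K%:E)%E) -> 0 <= K ->
  (\int[P]_w (overflow r A (fun i t => X i t w))%:E <=
  (A `^ (- r) * (p * n)%:R `^ (Num.max r 1 - 1) * (p%:R * (p * n)%:R * K ^+ 2))%:E)%E.
Proof.
move=> hK K0.
have mX i t : measurable_fun setT (fun w => `|X i t w| `^ r).
  apply: (measurableT_comp (measurable_powR r)).
  by apply: measurableT_comp => //; exact: measurable_funPT.
have mtup i : measurable_fun setT (fun w => [tuple X i t w | t < n]).
  apply/measurable_fun_tnthP => k.
  rewrite (_ : _ \o _ = X i k); first exact: measurable_funPT.
  by apply/funext => w /=; rewrite tnth_mktuple.
have pairE i j t : j != i ->
    (\int[P]_w (`|X i t w| `^ r * `|X j t w| `^ r)%:E <= (K ^+ 2)%:E)%E.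
  move=> ji.
  pose g (_ : 'I_p) (v : n.-tuple R) : R := `|tnth v t| `^ r.
  have := @integral_prod_indep R _ T P _ _ _ _ [:: i; j] g mtup hX.
  have mg k : measurable_fun setT (g k).
    apply: (measurableT_comp (measurable_powR r)).
    by apply: measurableT_comp => //; exact: measurable_tnth.
  have g0 k v : 0 <= g k v by exact: powR_ge0.
  have us : uniq [:: i; j] by rewrite /= inE eq_sym ji.
  move=> /(_ mg g0 us).
  rewrite big_cons big_seq1.
  under eq_integral do rewrite big_cons big_seq1 /g !tnth_mktuple.
  move=> ->.
  rewrite expr2 EFinM; apply: lee_pmul.
  - by apply: integral_ge0 => w _; rewrite lee_fin.
  - by apply: integral_ge0 => w _; rewrite lee_fin.
  - by under eq_integral do rewrite /g tnth_mktuple.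
  - by under eq_integral do rewrite /g tnth_mktuple.
set c := A `^ (- r) * _.
have c0 : 0 <= c by rewrite mulr_ge0 ?powR_ge0.
have mXX i j t : measurable_fun setT (fun w => `|X i t w| `^ r * `|X j t w| `^ r).
  exact: measurable_funM.
have XX0 i j t w : 0 <= `|X i t w| `^ r * `|X j t w| `^ r by rewrite mulr_ge0 ?powR_ge0.
have mXXs i j : measurable_fun setT (fun w => \sum_t `|X i t w| `^ r * `|X j t w| `^ r).
  exact: measurable_sum.
have XXs0 i j w : 0 <= \sum_t `|X i t w| `^ r * `|X j t w| `^ r by exact: sumr_ge0.
have mXXss i : measurable_fun setT (fun w => \sum_(j | j != i) \sum_t `|X i t w| `^ r * `|X j t w| `^ r).
  under eq_fun do rewrite big_mkcond.
  by apply: measurable_sum => j; case: (j != i).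
have XXss0 i w : 0 <= \sum_(j | j != i) \sum_t `|X i t w| `^ r * `|X j t w| `^ r.
  exact: sumr_ge0.
under eq_integral do rewrite /overflow -/c EFinM.
rewrite ge0_integralZl_EFin//; last 2 first.
- by move=> w _; rewrite lee_fin sumr_ge0.
- by apply/measurable_EFinP; exact: measurable_sum.
rewrite [leRHS]EFinM; apply: lee_wpmul2l => //.
apply: le_trans (_ : (\sum_(i < p) \sum_(j | j != i) \sum_(t < n) K ^+ 2)%:E <= _)%E.
  apply: integral_sum_le => // i _; apply: integral_sum_le => // j ji.
  by apply: integral_sum_le => // t _; exact: pairE.
rewrite lee_fin.
apply: (@le_trans _ _ (\sum_(i < p) \sum_(j < p) \sum_(t < n) K ^+ 2)).
  apply: ler_sum => i _; rewrite [leLHS]big_mkcond/=; apply: ler_sum => j _.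
  by case: ifP => // _; apply: sumr_ge0 => t _; exact: sqr_ge0.
rewrite !sumr_const !card_ord -!mulrnA -mulr_natl !natrM.
by rewrite le_eqVlt; apply/orP; left; apply/eqP; ring.
Qed.

End overflow_expectation.

(** * Exponents, rates and elementary limits *)

(** At r = s = alpha the two conclusions read 2 - max (alpha, 1) <= 1 and
    beta < (2 - max (alpha, 1)) (1 + beta); the second one is the growth
    condition when alpha > 1 and is trivial otherwise. Both survive a small
    perturbation r = alpha (1 - eta), s = alpha / (1 - eta). *)
Lemma exponent_choice (R : realType) (alpha beta : R) : 0 < alpha < 2 -> 0 < beta ->
  (1 < alpha -> beta < (2 - alpha) / (alpha - 1)) ->
  exists r s : R, [/\ 0 < r < alpha, alpha < s, 2 * (r / s) - Num.max r 1 <= 1 &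
    beta < (2 * (r / s) - Num.max r 1) * (1 + beta)].
Proof.
move=> /andP[a0 a2] b0 hb.
(* D is the slack in the second condition at r = s = alpha. *)
pose a' := Num.max alpha 1.
pose D := (2 - a') * (1 + beta) - beta.
have D0 : 0 < D.
  rewrite /D /a'; have [a1|a1] := leP alpha 1; first by lra.
  by have := hb a1; rewrite ltr_pdivlMr ?subr_gt0//; nra.
have b1 : 0 < 1 + beta by rewrite addr_gt0.
pose eta := Num.min (1 / 2) (D / (8 * (1 + beta))).
have eta0 : 0 < eta by rewrite lt_min divr_gt0//= divr_gt0// mulr_gt0.
have etah : eta <= 1 / 2 by rewrite ge_min lexx.
have etaD : eta * (8 * (1 + beta)) <= D.
  by rewrite -ler_pdivlMr ?mulr_gt0// ge_min lexx orbT.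
have eta1 : 0 < 1 - eta by lra.
exists (alpha * (1 - eta)), (alpha / (1 - eta)).
have rs : alpha * (1 - eta) / (alpha / (1 - eta)) = (1 - eta) ^+ 2.
  by field; rewrite !gt_eqF.
have mle : Num.max (alpha * (1 - eta)) 1 <= a'.
  rewrite ge_max !le_max lexx orbT andbT; apply/orP; left; nra.
split.
- by rewrite mulr_gt0//= gtr_pMr//; lra.
- by rewrite ltr_pdivlMr// gtr_pMr//; lra.
- rewrite rs.
  have : 1 <= Num.max (alpha * (1 - eta)) 1 by rewrite le_max lexx orbT.
  have : (1 - eta) ^+ 2 <= 1 by nra.
  lra.
- rewrite rs.
  have h : 2 - 4 * eta - a' <= 2 * (1 - eta) ^+ 2 - Num.max (alpha * (1 - eta)) 1.
    have := sqr_ge0 eta; lra.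
  apply: lt_le_trans (_ : (2 - 4 * eta - a') * (1 + beta) <= _).
    by move: D0 etaD; rewrite /D; lra.
  by rewrite ler_pM2r.
Qed.

Lemma limn_esup_lty_bounded (R : realType) (u : nat -> R) :
  (limn_esup (fun n => (u n)%:E) < +oo)%E ->
  exists2 C, 0 < C & \forall n \near \oo, u n <= C.
Proof.
rewrite /limn_esup /limf_esup => /ereal_inf_lt[_ [V oV <-]] supV.
have [l hl] : exists l : R, (ereal_sup [set (u n)%:E | n in V] <= l%:E)%E.
  move: supV; case: (ereal_sup _) => [l _|//|_]; first by exists l.
  by exists 0; rewrite leNye.
exists (Num.max 1 l); first by rewrite lt_max ltr01.
apply: filterS oV => n Vn; rewrite le_max -lee_fin; apply/orP; right.
rewrite -lee_fin; apply: le_trans hl; apply: ereal_sup_ubound.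
by exists n.
Qed.

(** The derivative of x ^ p on the unit interval is at most p. *)
Lemma normr_subX_le (R : realType) (x y : R) (p : nat) :
  0 <= x <= 1 -> 0 <= y <= 1 -> `|x ^+ p - y ^+ p| <= p%:R * `|x - y|.
Proof.
move=> /andP[x0 x1] /andP[y0 y1]; rewrite subrXX normrM mulrC ler_wpM2r//.
rewrite (le_trans (ler_norm_sum _ _ _))//.
rewrite -[X in _ <= X%:R]card_ord -[leRHS]mulr1 mulr_natl -sumr_const.
apply: ler_sum => i _; rewrite ger0_norm ?mulr_ge0 ?exprn_ge0//.
by rewrite mulr_ile1 ?exprn_ge0// exprn_ile1.
Qed.

(** As |1 - u - exp (- u)| <= u ^ 2 on the unit interval, (1 - u) ^ p and
    exp (- p u) differ by at most p u ^ 2 = (p u) ^ 2 / p. *)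
Lemma cvg_one_sub_pow (R : realType) (p : nat -> nat) (u : nat -> R) (l : R) :
  p n @[n --> \oo] --> \oo -> (forall n, (0 < p n)%N) -> (forall n, 0 <= u n <= 1) ->
  (p n)%:R * u n @[n --> \oo] --> l ->
  (1 - u n) ^+ p n @[n --> \oo] --> expR (- l).
Proof.
move=> poo p0 u01 pul.
have uE n : `|(1 - u n) ^+ p n - expR (- ((p n)%:R * u n))| <=
    ((p n)%:R * u n) ^+ 2 * (p n)%:R^-1.
  have /andP[u0 u1] := u01 n.
  have -> : expR (- ((p n)%:R * u n)) = expR (- u n) ^+ p n.
    by rewrite -expRM_natl mulrN.
  apply: (le_trans (normr_subX_le _ _ _)).
  - by rewrite subr_ge0 u1/= gerBl.
  - by rewrite expR_ge0/= -expR0 ler_expR oppr_le0.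
  have -> : ((p n)%:R * u n) ^+ 2 * (p n)%:R^-1 = (p n)%:R * u n ^+ 2.
    by field; rewrite pnatr_eq0 -lt0n.
  apply: ler_wpM2l => //.
  have e1 : 1 - u n <= expR (- u n) by exact: expR_ge1Dx.
  have e2 : expR (- u n) <= 1 - u n + u n ^+ 2.
    have eu : 1 + u n <= expR (u n) by exact: expR_ge1Dx.
    rewrite expRN -[leLHS]mul1r ler_pdivrMr ?expR_gt0//.
    apply: (@le_trans _ _ ((1 - u n + u n ^+ 2) * (1 + u n))); first nra.
    by rewrite ler_wpM2l//; nra.
  by rewrite distrC ger0_norm ?subr_ge0//; lra.
have pinv : ((p n)%:R^-1 : R) @[n --> \oo] --> (0 : R).
  apply/gtr0_cvgV0; first by apply: nearW => n; rewrite ltr0n.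
  exact: (cvg_comp _ _ poo (@cvgr_idn R)).
have lim0 : ((p n)%:R * u n) ^+ 2 * (p n)%:R^-1 @[n --> \oo] --> (0 : R).
  have h := cvgM (cvgM pul pul) pinv; rewrite mulr0 in h.
  exact: h.
have limexp : expR (- ((p n)%:R * u n)) @[n --> \oo] --> expR (- l).
  exact: (cvg_comp _ _ (cvgN pul) (@continuous_expR R (- l))).
have diff0 : (1 - u n) ^+ p n - expR (- ((p n)%:R * u n)) @[n --> \oo] --> (0 : R).
  apply/norm_cvg0P; apply: (squeeze_cvgr _ (cvg_cst 0) lim0).
  by apply: nearW => n; rewrite normr_ge0 uE.
have h := cvgD diff0 limexp; rewrite add0r in h.
rewrite (_ : (fun n => (1 - u n) ^+ p n) = (fun n => (1 - u n) ^+ p n -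
    expR (- ((p n)%:R * u n)) + expR (- ((p n)%:R * u n)))); first exact: h.
by apply/funext => n; rewrite subrK.
Qed.

Lemma cvg_powRN_nat (R : realType) (th : R) : 0 < th ->
  (n%:R `^ (- th) : R) @[n --> \oo] --> (0 : R).
Proof.
move=> th0; under eq_fun do rewrite powRN.
have pos : \forall n \near \oo, 0 < n%:R `^ th :> R.
  by exists 1%N => // n /= n1; rewrite powR_gt0// ltr0n.
apply/gtr0_cvgV0 => //; apply/cvgryPge => A.
near=> n.
have An : (Num.max A 1) `^ th^-1 <= n%:R.
  by near: n; exact: nbhs_infty_ger.
have A1 : 0 <= Num.max A 1 by rewrite le_max ler01 orbT.
apply: (@le_trans _ _ (Num.max A 1)); first by rewrite le_max lexx.
have -> : Num.max A 1 = (Num.max A 1 `^ th^-1) `^ th.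
  by rewrite -powRrM mulVf ?powRr1// gt_eqF.
by apply: ge0_ler_powR; rewrite ?nnegrE ?powR_ge0// ltW.
Unshelve. all: by end_near. Qed.

(** With kap = 2 r / s - max (r, 1) and N = n p n, the expression is bounded by a
    constant times p n N ^ (- kap), and p n <= C n ^ beta makes this at most a
    constant times n ^ (beta - kap (1 + beta)). *)
Lemma overflow_rate (R : realType) (r s beta C c del K : R) (p : nat -> nat) (a : nat -> R) :
  0 < r -> 0 < s -> 0 < c -> 0 < C -> 0 < del ->
  2 * (r / s) - Num.max r 1 <= 1 ->
  beta < (2 * (r / s) - Num.max r 1) * (1 + beta) ->
  (forall n, (0 < p n)%N) ->
  (\forall m \near \oo, c * m%:R <= a m `^ s) -> (\forall m \near \oo, 0 < a m) ->
  (\forall n \near \oo, (p n)%:R <= C * n%:R `^ beta) ->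
  (del * a (n * p n)%N ^+ 2) `^ (- r) * (p n * n)%:R `^ (Num.max r 1 - 1) *
    ((p n)%:R * (p n * n)%:R * K ^+ 2) @[n --> \oo] --> (0 : R).
Proof.
move=> r0 s0 c0 C0 del0 kap1 kapb p0 ca a0 pC.
pose m := Num.max r 1; rewrite -/m; rewrite -/m in kap1; rewrite -/m in kapb.
pose kap := 2 * (r / s) - m.
pose th := kap * (1 + beta) - beta.
have th0 : 0 < th by rewrite subr_gt0.
pose B := del `^ (- r) * c `^ (- (2 * (r / s))) * K ^+ 2 * C `^ (1 - kap).
have Np : (n * p n)%N @[n --> \oo] --> \oo.
  move=> S [N _ NS]; exists N => // n /= Nn; apply: NS => /=.
  by rewrite (leq_trans Nn)// leq_pmulr.
have limB : B * n%:R `^ (- th) @[n --> \oo] --> (0 : R).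
  have h := cvgM (cvg_cst B) (cvg_powRN_nat th0).
  by rewrite mulr0 in h; exact: h.
apply: (squeeze_cvgr _ (cvg_cst 0) limB).
near=> n.
have n0 : (0 < n)%N by near: n; exists 1%N.
have nR : 0 < n%:R :> R by rewrite ltr0n.
have pR : 0 < (p n)%:R :> R by rewrite ltr0n.
pose N : R := (n * p n)%:R.
have N0 : 0 < N by rewrite ltr0n muln_gt0 n0 p0.
have an0 : 0 < a (n * p n)%N by near: n; exact: (Np _ a0).
have can : c * (n * p n)%:R <= a (n * p n)%N `^ s by near: n; exact: (Np _ ca).
have pn : (p n)%:R <= C * n%:R `^ beta by near: n.
have -> : (p n * n)%:R = N by rewrite mulnC.
apply/andP; split.
  apply: mulr_ge0; first by apply: mulr_ge0; exact: powR_ge0.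
  by apply: mulr_ge0; [apply: mulr_ge0; exact: ltW|exact: sqr_ge0].
have e1 : (del * a (n * p n)%N ^+ 2) `^ (- r) <=
    del `^ (- r) * (c `^ (- (2 * (r / s))) * N `^ (- (2 * (r / s)))).
  rewrite powRM ?(ltW del0) ?sqr_ge0//; apply: ler_wpM2l; first exact: powR_ge0.
  rewrite -powRM ?(ltW c0) ?(ltW N0)//.
  have -> : (a (n * p n)%N ^+ 2) `^ (- r) = (a (n * p n)%N `^ s) `^ (- (2 * (r / s))).
    rewrite -powR_mulrn ?(ltW an0)// -!powRrM; congr (_ `^ _).
    by field; rewrite gt_eqF.
  rewrite !powRN lef_pV2 ?posrE ?powR_gt0 ?mulr_gt0//.
  by apply: ge0_ler_powR; rewrite ?nnegrE ?powR_ge0 ?mulr_ge0 ?invr_ge0 ?(ltW r0) ?(ltW s0) ?(ltW c0) ?(ltW N0)//.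
have e2 : N `^ (- (2 * (r / s))) * N `^ (m - 1) * N = N `^ (- kap).
  rewrite -[X in _ * _ * X = _](powRr1 (ltW N0)) -!powRD; try by rewrite (gt_eqF N0) implybT.
  by congr (_ `^ _); rewrite /kap; ring.
have e3 : (p n)%:R * N `^ (- kap) <= C `^ (1 - kap) * n%:R `^ (- th).
  rewrite /N natrM powRM ?ler0n//.
  have -> : (p n)%:R * (n%:R `^ (- kap) * (p n)%:R `^ (- kap)) =
     n%:R `^ (- kap) * (p n)%:R `^ (1 - kap) :> R.
    rewrite powRD; last by rewrite (gt_eqF pR) implybT.
    by rewrite powRr1 ?ler0n//; ring.
  apply: (@le_trans _ _ (n%:R `^ (- kap) * (C * n%:R `^ beta) `^ (1 - kap))).
    apply: ler_wpM2l; first exact: powR_ge0.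
    apply: ge0_ler_powR; rewrite ?nnegrE ?subr_ge0//.
    by rewrite mulr_ge0 ?powR_ge0 ?(ltW C0).
  rewrite powRM ?powR_ge0 ?(ltW C0)// -powRrM mulrCA -powRD; last by rewrite (gt_eqF nR) implybT.
  by rewrite le_eqVlt; apply/orP; left; apply/eqP; congr (_ * _ `^ _); rewrite /th; ring.
apply: (@le_trans _ _ (del `^ (- r) * (c `^ (- (2 * (r / s))) * N `^ (- (2 * (r / s)))) *
   N `^ (m - 1) * ((p n)%:R * N * K ^+ 2))).
  apply: ler_wpM2r; first by apply: mulr_ge0; [apply: mulr_ge0; exact: ltW|exact: sqr_ge0].
  by apply: ler_wpM2r => //; exact: powR_ge0.
have -> : del `^ (- r) * (c `^ (- (2 * (r / s))) * N `^ (- (2 * (r / s)))) *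
   N `^ (m - 1) * ((p n)%:R * N * K ^+ 2) =
   (del `^ (- r) * c `^ (- (2 * (r / s))) * K ^+ 2) * ((p n)%:R * N `^ (- kap)).
  by rewrite -e2; ring.
rewrite /B -[leRHS]mulrA; apply: ler_wpM2l => //.
by apply: mulr_ge0; [apply: mulr_ge0; exact: powR_ge0|exact: sqr_ge0].
Unshelve. all: by end_near. Qed.

(** * Test functions and the limiting intensity *)

(** Heine's theorem on a unit neighbourhood of the support; beyond it the function
    vanishes at both points. *)
Lemma unif_continuous_support (R : realType) (f : R -> R) (c C eps : R) :
  continuous f -> (forall x, x <= c -> f x = 0) -> (forall x, C <= x -> f x = 0) ->
  0 < eps ->
  exists2 eta, 0 < eta & forall x y, `|x - y| <= eta -> `|f x - f y| <= eps.
Proof.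
move=> cf fc fC eps0.
have e20 : 0 < eps / 2 by rewrite divr_gt0.
have cov : compact `[c - 1, C + 1] by exact: segment_compact.
move/compact_near_coveringP : cov.
move=> /(_ R (0 : R)^'+ (fun eta x => forall y, `|x - y| <= eta -> `|f x - f y| <= eps)).
case.
- move=> x _.
  have /cvgrPdist_le/(_ _ e20) := cf x.
  move=> /nbhs_ballP[d /= d0 fd].
  exists (ball x (d / 2), [set eta | eta < d / 2]).
    split => /=; first by apply: nbhsx_ballx; rewrite divr_gt0.
    by apply: nbhs_right_lt; rewrite divr_gt0.
  move=> [x' eta] /= [xx' etad] y xy.
  have fx' : `|f x - f x'| <= eps / 2.
    by apply: fd; rewrite /ball/= (lt_le_trans xx')//; lra.
  have fy : `|f x - f y| <= eps / 2.
    apply: fd; rewrite /ball/=.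
    have -> : x - y = (x - x') + (x' - y) by ring.
    by rewrite (le_lt_trans (ler_normD _ _))//; move: xx'; rewrite /ball/=; lra.
  have -> : f x' - f y = (f x - f y) - (f x - f x') by ring.
  by rewrite (le_trans (ler_normB _ _))//; lra.
move=> A A0 HA.
have [eta [eta0 [eta1 Aeta]]] : exists eta : R, 0 < eta /\ eta <= 1 /\
    (forall x, x \in `[c - 1, C + 1] -> forall y, `|x - y| <= eta -> `|f x - f y| <= eps).
  exists (Num.min 1 (A / 2)).
  have mpos : 0 < Num.min 1 (A / 2) by rewrite lt_min ltr01 divr_gt0.
  split => //; split; first by rewrite ge_min lexx.
  move=> x xin y xy.
  apply: (HA (Num.min 1 (A / 2))) => //.
  rewrite /= sub0r normrN gtr0_norm// gt_min; apply/orP; right.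
  by rewrite ltr_pdivrMr//; move: A0 => /=; lra.
exists eta => // x y xy.
have [xin|] := boolP (x \in `[c - 1, C + 1]); first exact: Aeta.
rewrite in_itv/= negb_and -!ltNge => /orP[xc|xC].
  rewrite (fc x) ?(fc y) ?subrr ?normr0 ?ltW//.
    by move: xy; rewrite ler_norml; lra.
  lra.
rewrite (fC x) ?(fC y) ?subrr ?normr0 ?ltW//.
  by move: xy; rewrite ler_norml; lra.
lra.
Qed.

Section test_function.
Context (R : realType) (f : R -> R).
Hypothesis hf : pos_test_function f.

Definition zero_ext : R -> R := f \_ [set y | 0 < y].

Lemma zero_ext_pos x : 0 < x -> zero_ext x = f x.
Proof. by move=> x0; rewrite /zero_ext patchE mem_set. Qed.

Lemma zero_ext_npos x : x <= 0 -> zero_ext x = 0.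
Proof.
by move=> x0; rewrite /zero_ext patchE memNset//= => /(le_lt_trans x0); rewrite ltxx.
Qed.

Lemma zero_ext_ge0 x : 0 <= zero_ext x.
Proof.
have [x0|x0] := leP x 0; first by rewrite zero_ext_npos.
by rewrite zero_ext_pos//; case: hf => _ /(_ x x0).
Qed.

Lemma zero_ext_support : exists c C, [/\ 0 < c, c < C,
  forall x, x <= c -> zero_ext x = 0 & forall x, C <= x -> zero_ext x = 0].
Proof.
have [_ _ [K [Kc K0 Kf]]] := hf.
have [M HM] : exists M, forall x, K x -> `|x| <= M.
  have [M [_ HM]] := compact_bounded Kc; exists (M + 1) => x Kx.
  by apply: (HM (M + 1)) => //; rewrite ltrDl.
have clK : closed K by apply: compact_closed => //; exact: norm_hausdorff.
have : nbhs (0 : R) (~` K).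
  apply: open_nbhs_nbhs; split; first exact: closed_openC.
  by move=> /K0 /=; rewrite ltxx.
move=> /nbhs_ballP[e /= e0 eK].
have cpos x : K x -> e <= x.
  move=> Kx; rewrite leNgt; apply/negP => xe; apply: (eK x) => //.
  by rewrite /ball/= sub0r normrN gtr0_norm//; exact: K0.
(* e separates the compact support from 0. *)
exists (e / 2), (Num.max e (M + 1)); split.
- by rewrite divr_gt0.
- by rewrite lt_max; apply/orP; left; rewrite ltr_pdivrMr//; lra.
- move=> x xe; have [x0|x0] := leP x 0; first by rewrite zero_ext_npos.
  rewrite zero_ext_pos// Kf// => /cpos; lra.
- move=> x; rewrite ge_max => /andP[ex Mx].
  have x0 : 0 < x by exact: lt_le_trans ex.
  rewrite zero_ext_pos// Kf// => Kx; have := HM x Kx; rewrite ger0_norm; last exact: ltW.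
  by move: Mx; lra.
Qed.

(** The support keeps away from 0, so no discontinuity is created there. *)
Lemma zero_ext_continuous : continuous zero_ext.
Proof.
have [c [C [c0 cC fc fC]]] := zero_ext_support.
move=> x; have [xc|cx] := ltP x c.
  have E : zero_ext x = 0 by rewrite fc// ltW.
  have h0 : cst (0 : R) y @[y --> x] --> (0 : R) by exact: cvg_cst.
  rewrite /continuous_at E; apply: (cvg_trans _ h0).
  apply: near_eq_cvg; near=> y; rewrite fc//; apply: ltW.
  by near: y; exact: lt_nbhsl.
have x0 : 0 < x by exact: lt_le_trans cx.
have [cf _ _] := hf.
have fx : f y @[y --> x] --> f x by apply: cf; rewrite in_itv/= x0.
rewrite /continuous_at zero_ext_pos//.
apply: (cvg_trans _ fx); apply: near_eq_cvg; near=> y.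
rewrite zero_ext_pos//.
by near: y; exact: lt_nbhsr.
Unshelve. all: by end_near. Qed.

End test_function.

Section power_intensity.
Context (R : realType) (alpha b : R).
Hypotheses (alpha0 : 0 < alpha) (b0 : 0 <= b).

(** The points of the limiting process are the images of the arrival times under
    this map. *)
Definition point_map (x : R) : R := b `^ (2 / alpha) * x `^ (- (2 / alpha)).

Let a20 : 0 < 2 / alpha.
Proof. by rewrite divr_gt0. Qed.

Lemma point_mapE x : 0 < x -> point_map x = (b / x) `^ (2 / alpha).
Proof.
move=> x0; rewrite /point_map powRM ?invr_ge0 ?(ltW x0)//.
by rewrite -[x^-1]powR_inv1 ?(ltW x0)// -powRrM mulN1r.
Qed.

Lemma point_map0 : point_map 0 = 0.
Proof. by rewrite /point_map powR0 ?mulr0// oppr_eq0 gt_eqF. Qed.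

Lemma point_map_gt x y : 0 < x -> 0 < y ->
  (y < point_map x) = (x < b * y `^ (- (alpha / 2))).
Proof.
move=> x0 y0.
have yE : y = (y `^ (alpha / 2)) `^ (2 / alpha).
  rewrite -powRrM (_ : alpha / 2 * (2 / alpha) = 1) ?powRr1 ?(ltW y0)//.
  by field; rewrite gt_eqF.
have bx : 0 <= b / x by rewrite divr_ge0// ltW.
have -> : (y < point_map x) = (y `^ (alpha / 2) < b / x).
  rewrite point_mapE// {1}yE; apply/idP/idP.
    rewrite !ltNge; apply: contra => h.
    by apply: ge0_ler_powR => //; [exact: ltW|rewrite nnegrE powR_ge0].
  by apply: gt0_ltr_powR => //; rewrite nnegrE powR_ge0.
by rewrite powRN ltr_pdivlMr// ltr_pdivlMr ?powR_gt0// mulrC.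
Qed.

Lemma measurable_point_map : measurable_fun setT point_map.
Proof. by apply: measurable_funM => //; exact: measurable_powR. Qed.

Lemma upper_mass_point_map x : 0 < x ->
  (lebesgue_measure (`]0%R, +oo[%classic `&` [set y | x < point_map y]%R) =
    (b * x `^ (- (alpha / 2)))%:E)%E.
Proof.
move=> x0.
rewrite (_ : _ `&` _ = `]0, b * x `^ (- (alpha / 2))[%classic).
  rewrite lebesgue_measure_itv/= lte_fin; case: ifPn.
    by rewrite oppr0 adde0.
  rewrite -leNgt => h; congr EFin; apply/eqP; rewrite eq_sym eq_le h/=.
  by rewrite mulr_ge0 ?powR_ge0.
apply/seteqP; split => y /=; rewrite !in_itv/= ?andbT.
  by move=> [y0]; rewrite point_map_gt// y0.
by move=> /andP[y0 yb]; split => //; rewrite point_map_gt.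
Qed.

Lemma point_map_continuous x : 0 < x -> {for x, continuous point_map}.
Proof.
move=> x0.
have h : {for x, continuous (fun y : R => y `^ (- (2 / alpha)))}.
  apply: differentiable_continuous; apply/derivable1_diffP.
  by apply: derivable_powR; rewrite in_itv/= x0.
by apply: cvgM; [exact: cvg_cst|exact: h].
Qed.

Context (f : R -> R).
Hypothesis hf : pos_test_function f.

(** The probability that an independent marking, which spares a point at x with
    probability exp (- f x), marks it. *)
Definition hit (x : R) : R := 1 - expR (- zero_ext f x).

Lemma hit_ge0 x : 0 <= hit x.
Proof. by rewrite subr_ge0 -expR0 ler_expR oppr_le0 zero_ext_ge0. Qed.

Lemma hit_le1 x : hit x <= 1.
Proof. by rewrite gerBl expR_ge0. Qed.

Lemma hit_eq0 x : zero_ext f x = 0 -> hit x = 0.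
Proof. by rewrite /hit => ->; rewrite oppr0 expR0 subrr. Qed.

Lemma hit_continuous : continuous hit.
Proof.
move=> x; apply: cvgB; first exact: cvg_cst.
apply: (@continuous_comp _ _ _ (fun x => - zero_ext f x) expR).
  by apply: continuousN; exact: zero_ext_continuous.
exact: continuous_expR.
Qed.

(** The function to which laplace_poisson applies. The value 0 on the left is also
    the limit at 0: for b > 0 small arrival times give points beyond the support
    of f, and for b = 0 all points are 0. *)
Definition hit_intensity (x : R) : R := if 0 < x then hit (point_map x) else 0.

Lemma hit_intensity_ge0 x : 0 <= hit_intensity x.
Proof. by rewrite /hit_intensity; case: ifP => // _; exact: hit_ge0. Qed.

Lemma hit_intensity_le1 x : hit_intensity x <= 1.
Proof. by rewrite /hit_intensity; case: ifP => // _; exact: hit_le1. Qed.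

Lemma hit_intensity_le0 x : x <= 0 -> hit_intensity x = 0.
Proof. by rewrite /hit_intensity leNgt => /negbTE ->. Qed.

Lemma hit_intensityE x : 0 <= x ->
  hit_intensity x = 1 - expR (- zero_ext f (point_map x)).
Proof.
rewrite le_eqVlt => /predU1P[<-|x0]; last by rewrite /hit_intensity x0.
rewrite /hit_intensity ltxx point_map0 -/(hit 0) hit_eq0//.
exact: zero_ext_npos.
Qed.

Lemma hit_intensity_right : exists M, forall x, M <= x -> hit_intensity x = 0.
Proof.
have [c [C [c0 cC fc fC]]] := zero_ext_support hf.
exists (b * c `^ (- (alpha / 2)) + 1) => x Mx.
have bx : b * c `^ (- (alpha / 2)) < x by rewrite (lt_le_trans _ Mx)// ltrDl.
have x0 : 0 < x by rewrite (le_lt_trans _ bx)// mulr_ge0 ?powR_ge0.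
rewrite /hit_intensity x0 hit_eq0// fc// leNgt point_map_gt//.
by rewrite -leNgt ltW.
Qed.

Lemma hit_intensity_continuous : continuous hit_intensity.
Proof.
have [c [C [c0 cC fc fC]]] := zero_ext_support hf.
have C0 : 0 < C by exact: lt_trans cC.
move=> x; have [x0|x0] := ltP 0 x.
  have h0 : hit (point_map y) @[y --> x] --> hit (point_map x).
    apply: (@continuous_comp _ _ _ point_map hit).
      exact: point_map_continuous.
    exact: hit_continuous.
  rewrite /continuous_at {2}/hit_intensity x0; apply: (cvg_trans _ h0).
  apply: near_eq_cvg; near=> y.
  have y0 : 0 < y by near: y; exact: lt_nbhsr.
  by rewrite /hit_intensity y0.
have h0 : cst (0 : R) y @[y --> x] --> (0 : R) by exact: cvg_cst.
rewrite /continuous_at hit_intensity_le0//; apply: (cvg_trans _ h0).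
apply: near_eq_cvg.
have [bE|bn0] := eqVneq b 0.
  apply: nearW => y; rewrite /hit_intensity; case: ifP => // _.
  rewrite hit_eq0//; apply: zero_ext_npos.
  by rewrite /point_map bE powR0 ?mul0r// gt_eqF.
have bC : 0 < b * C `^ (- (alpha / 2)).
  by rewrite mulr_gt0 ?powR_gt0// lt_neqAle eq_sym bn0.
near=> y; rewrite /hit_intensity; case: ifPn => // y0.
rewrite hit_eq0// fC// ltW// point_map_gt//.
by near: y; apply: lt_nbhsl; exact: le_lt_trans bC.
Unshelve. all: by end_near. Qed.

Lemma integral_hit_intensity :
  \int[lebesgue_measure]_(x in `]0, +oo[) hit (point_map x) =
  \int[lebesgue_measure]_x hit_intensity x.
Proof.
rewrite Rintegral_mkcond; congr fine; apply: eq_integral => x _.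
rewrite /hit_intensity patchE; case: ifPn.
  by rewrite inE/= in_itv/= andbT => ->.
by rewrite notin_setE/= in_itv/= andbT => /negP/negbTE ->.
Qed.

End power_intensity.

(** * Replacing the eigenvalues by the row energies *)

Lemma eq_law_integral (R : realType) d1 d2 d' (T1 : measurableType d1)
    (T2 : measurableType d2) (U : measurableType d') (P1 : probability T1 R)
    (P2 : probability T2 R) (Y1 : T1 -> U) (Y2 : T2 -> U) (F : U -> \bar R) :
  eq_law P1 P2 Y1 Y2 -> measurable_fun setT Y1 -> measurable_fun setT Y2 ->
  measurable_fun setT F -> (forall u, 0 <= F u)%E ->
  (\int[P1]_w F (Y1 w) = \int[P2]_w F (Y2 w))%E.
Proof.
move=> law m1 m2 mF F0.
pose Z1 : {mfun T1 >-> U} := HB.pack Y1 (isMeasurableFun.Build _ _ _ _ Y1 m1).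
pose Z2 : {mfun T2 >-> U} := HB.pack Y2 (isMeasurableFun.Build _ _ _ _ Y2 m2).
transitivity (\int[distribution P1 Z1]_u F u)%E.
  by rewrite ge0_integral_distribution.
transitivity (\int[distribution P2 Z2]_u F u)%E.
  by apply: eq_measure_integral => A mA _; exact: law.
by rewrite ge0_integral_distribution.
Qed.

(** The integral of a nonnegative function is a supremum over the simple functions
    below it, hence monotone even for functions that are not measurable. The
    eigenvalues, listed in an arbitrary order depending on the sample point,
    need not be measurable. *)
Lemma ge0_le_integral_nonmeas (R : realType) d (T : measurableType d)
    (mu : {measure set T -> \bar R}) (f g : T -> \bar R) :
  (forall x, 0 <= f x)%E -> (forall x, f x <= g x)%E ->
  (\int[mu]_x f x <= \int[mu]_x g x)%E.
Proof.
move=> f0 fg.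
have g0 x : (0 <= g x)%E by exact: le_trans (fg x).
rewrite !ge0_integralTE//; apply: ereal_sup_le => _ [h hf <-].
by exists h => // x; exact: le_trans (fg x).
Qed.

(** The function F is caught between g - e and g + e, which are measurable, so that
    additivity of the integral is used on these only. *)
Lemma integral_close (R : realType) d (T : measurableType d)
    (P : probability T R) (F g e : T -> R) :
  (forall w, 0 <= F w) -> (forall w, 0 <= g w) -> (forall w, 0 <= e w) ->
  measurable_fun setT g -> measurable_fun setT e ->
  (forall w, `|F w - g w| <= e w) ->
  (\int[P]_w (F w)%:E <= \int[P]_w (g w)%:E + \int[P]_w (e w)%:E)%E /\
  (\int[P]_w (g w)%:E <= \int[P]_w (F w)%:E + \int[P]_w (e w)%:E)%E.
Proof.
move=> F0 g0 e0 mg me Fge.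
have mgE : measurable_fun setT (EFin \o g) by exact/measurable_EFinP.
have meE : measurable_fun setT (EFin \o e) by exact/measurable_EFinP.
split.
  rewrite -ge0_integralD//; last 2 first.
  - by move=> w _; rewrite lee_fin.
  - by move=> w _; rewrite lee_fin.
  apply: ge0_le_integral_nonmeas => w; first by rewrite lee_fin.
  by rewrite -EFinD lee_fin; have := Fge w; rewrite ler_norml; lra.
(* g - e may be negative, while the integral of F is compared through
nonnegative functions. *)
pose k w := Num.max (g w - e w) 0.
have mk : measurable_fun setT k.
  by apply: measurable_maxr => //; exact: measurable_funB.
have k0 w : 0 <= k w by rewrite le_max lexx orbT.
have mkE : measurable_fun setT (EFin \o k) by exact/measurable_EFinP.
apply: (@le_trans _ _ (\int[P]_w (k w)%:E + \int[P]_w (e w)%:E)%E).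
  rewrite -ge0_integralD//; last 2 first.
  - by move=> w _; rewrite lee_fin.
  - by move=> w _; rewrite lee_fin.
  apply: ge0_le_integral_nonmeas => w; first by rewrite lee_fin.
  by rewrite -EFinD lee_fin -lerBlDr /k le_max lexx.
rewrite leeD2r//; apply: ge0_le_integral_nonmeas => w; rewrite lee_fin//.
by rewrite /k ge_max F0 andbT; have := Fge w; rewrite ler_norml; lra.
Qed.

Lemma expRN_close (R : realType) (x y : R) : 0 <= x -> 0 <= y ->
  `|expR (- x) - expR (- y)| <= `|x - y|.
Proof.
wlog xy : x y / x <= y.
  move=> H x0 y0; have [xy|/ltW yx] := leP x y; first exact: H.
  by rewrite distrC [leRHS]distrC; exact: H.
move=> x0 y0.
rewrite ger0_norm; last by rewrite subr_ge0 ler_expR lerN2.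
rewrite distrC ger0_norm ?subr_ge0//.
have e1 : expR (- x) <= 1 by rewrite -expR0 ler_expR oppr_le0.
have e2 : 1 - (y - x) <= expR (- (y - x)) by exact: expR_ge1Dx.
have -> : expR (- y) = expR (- x) * expR (- (y - x)).
  by rewrite -expRD; congr expR; ring.
have ex0 := expR_gt0 (- x).
nra.
Qed.

(** A term with s j <= c / 2 vanishes before and after the perturbation; each of
    the others changes by at most om. *)
Lemma sum_perturbation (R : realType) (p : nat) (g : R -> R) (c del om : R)
    (l s : 'I_p -> R) (sg : 'S_p) :
  0 < c -> (forall x, x <= c -> g x = 0) -> 0 <= om -> del <= c / 2 ->
  (forall x y, `|x - y| <= del -> `|g x - g y| <= om) ->
  (forall j, `|l (sg j) - s j| <= del) ->
  `|\sum_i g (l i) - \sum_i g (s i)| <= om * \sum_i (c / 2 < s i)%R%:R.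
Proof.
move=> c0 gc om0 delc gu ls.
rewrite (reindex_inj (@perm_inj _ sg))/= -sumrB (le_trans (ler_norm_sum _ _ _))//.
rewrite mulr_sumr; apply: ler_sum => j _.
have [sc|cs] := leP (s j) (c / 2); last by rewrite mulr1; exact: gu.
have := ls j; rewrite ler_norml => /andP[_ lsj].
by rewrite mulr0 !gc ?subrr ?normr0//; lra.
Qed.

(** If overflow is at least 1 the bound is trivial, both exponentials being in the
    unit interval. Otherwise all off-diagonal row sums are at most del a2 and
    weyl_perm applies. *)
Lemma eigenvalues_perturbation (R : realType) (p n : nat) (x : 'I_p -> 'I_n -> R)
    (lam : 'I_p -> R) (g : R -> R) (c del om a2 r : R) :
  let M : 'M[R]_(p, n) := \matrix_(i, t) x i t in
  eigenvalues_of (M *m M^T) lam ->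
  0 < a2 -> 0 < del -> del <= c / 2 -> 0 <= om -> 0 < r ->
  (forall x, 0 <= g x) -> (forall x, x <= c -> g x = 0) ->
  (forall x y, `|x - y| <= del -> `|g x - g y| <= om) ->
  `|expR (- \sum_i g (a2^-1 * lam i)) -
    expR (- \sum_i g (a2^-1 * \sum_t x i t ^+ 2))| <=
  overflow r (del * a2) x + om * \sum_i (c / 2 < a2^-1 * \sum_t x i t ^+ 2)%R%:R.
Proof.
move=> M lamM a20 del0 delc om0 r0 g0 gc gu.
have gs0 (y : 'I_p -> R) : 0 <= \sum_i g (y i) by exact: sumr_ge0.
have ind0 (y : 'I_p -> R) : 0 <= om * \sum_i (c / 2 < y i)%R%:R.
  by rewrite mulr_ge0// sumr_ge0.
have [ov|ov] := leP 1 (overflow r (del * a2) x).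
  apply: (@le_trans _ _ 1); last by rewrite -[leLHS]addr0 lerD.
  have e1 (y : 'I_p -> R) : expR (- \sum_i g (y i)) <= 1.
    by rewrite -expR0 ler_expR oppr_le0.
  have := e1 (fun i => a2^-1 * lam i).
  have := e1 (fun i => a2^-1 * \sum_t x i t ^+ 2).
  have := expR_gt0 (- \sum_i g (a2^-1 * lam i)).
  have := expR_gt0 (- \sum_i g (a2^-1 * \sum_t x i t ^+ 2)).
  by rewrite ler_norml; lra.
have offd i : \sum_(j | j != i) `|(M *m M^T) i j| <= del * a2.
  rewrite leNgt; apply/negP => h.
  have : 1 <= overflow r (del * a2) x.
    apply: (overflow_ge1 (i := i)) => //; first exact: mulr_gt0.
    apply: lt_le_trans h _; apply: ler_sum => j _.
    have -> : (M *m M^T) i j = \sum_t x i t * x j t.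
      by rewrite mxE; apply: eq_bigr => t _; rewrite !mxE.
    exact: lexx.
  by rewrite leNgt ov.
have Msym : (M *m M^T)^T = M *m M^T by rewrite trmx_mul trmxK.
have [sg sgP] := weyl_perm Msym lamM offd.
have diagE i : (M *m M^T) i i = \sum_t x i t ^+ 2.
  by rewrite mxE; apply: eq_bigr => t _; rewrite !mxE expr2.
apply: (le_trans (expRN_close _ _)) => //.
rewrite -[leLHS]add0r lerD ?overflow_ge0//.
have c0 : 0 < c by lra.
apply: (@sum_perturbation _ _ _ _ del _ _ _ sg) => // j.
rewrite -mulrBr normrM gtr0_norm ?invr_gt0// mulrC ler_pdivrMr//.
by rewrite -diagE.
Qed.

(** * The Laplace functional for a matrix of fixed size *)

Section fixed_size.
Context (R : realType) (p n : nat) d (T : measurableType d) (P : probability T R)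
  (X : 'I_p -> 'I_n -> {RV P >-> R}) d0 (T0 : measurableType d0)
  (P0 : probability T0 R) (Z : 'I_n -> {RV P0 >-> R}).
Hypotheses (hindep : mutually_independent P (fun i w => [tuple X i t w | t < n]))
  (hcopy : forall i, eq_law P P0 (fun w => [tuple X i t w | t < n])
     (fun w => [tuple Z t w | t < n])).
Variables (f : R -> R) (a2 : R).
Hypotheses (hf : pos_test_function f) (a20 : 0 < a2).

Definition scaled_energy (w : T0) : R := a2^-1 * \sum_t Z t w ^+ 2.

Let tuple_energy (v : n.-tuple R) : R := a2^-1 * \sum_t tnth v t ^+ 2.

Let mtuple_energy : measurable_fun setT tuple_energy.
Proof.
apply: measurable_funM => //; apply: measurable_sum => t.
by apply: measurable_funX; exact: measurable_tnth.
Qed.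

Let mrow i : measurable_fun setT (fun w => [tuple X i t w | t < n]).
Proof.
apply/measurable_fun_tnthP => k; rewrite (_ : _ \o _ = X i k); first exact: measurable_funPT.
by apply/funext => w /=; rewrite tnth_mktuple.
Qed.

Let mZrow : measurable_fun setT (fun w => [tuple Z t w | t < n]).
Proof.
apply/measurable_fun_tnthP => k; rewrite (_ : _ \o _ = Z k); first exact: measurable_funPT.
by apply/funext => w /=; rewrite tnth_mktuple.
Qed.

Let rowE i w : a2^-1 * \sum_t X i t w ^+ 2 = tuple_energy [tuple X i t w | t < n].
Proof. by rewrite /tuple_energy; congr (_ * _); apply: eq_bigr => t _; rewrite tnth_mktuple. Qed.

Let ZrowE w : scaled_energy w = tuple_energy [tuple Z t w | t < n].
Proof.
by rewrite /scaled_energy /tuple_energy; congr (_ * _); apply: eq_bigr => t _; rewrite tnth_mktuple.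
Qed.

Lemma measurable_scaled_energy : measurable_fun setT scaled_energy.
Proof.
rewrite (_ : scaled_energy = tuple_energy \o (fun w => [tuple Z t w | t < n])).
  exact: measurableT_comp.
by apply/funext => w; exact: ZrowE.
Qed.

Let row_integral (F : R -> R) i : measurable_fun setT F -> (forall x, 0 <= F x) ->
  (\int[P]_w (F (a2^-1 * \sum_t X i t w ^+ 2))%:E = \int[P0]_w (F (scaled_energy w))%:E)%E.
Proof.
move=> mF F0.
under eq_integral do rewrite rowE.
under [RHS]eq_integral do rewrite ZrowE.
apply: (eq_law_integral (F := fun v => (F (tuple_energy v))%:E) (hcopy i)) => //.
- by apply/measurable_EFinP; exact: measurableT_comp mF mtuple_energy.
- by move=> v; rewrite lee_fin.
Qed.

Definition hit_prob : R := \int[P0]_w hit f (scaled_energy w).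

Let mhit : measurable_fun setT (fun w => hit f (scaled_energy w)).
Proof.
apply: (@measurableT_comp _ _ _ _ _ _ (hit f)); last exact: measurable_scaled_energy.
exact: continuous_measurable_fun (hit_continuous hf).
Qed.

Let ihit : P0.-integrable setT (EFin \o (fun w => hit f (scaled_energy w))).
Proof.
apply: (@le_integrable _ _ _ P0 setT _ _ (cst 1%E)) => //.
- exact/measurable_EFinP.
- by move=> w _ /=; rewrite lee_fin normr1 ger0_norm ?hit_ge0// hit_le1.
- exact: finite_measure_integrable_cst.
Qed.

Lemma hit_prob01 : 0 <= hit_prob <= 1.
Proof.
apply/andP; split; first by apply: Rintegral_ge0 => w _; exact: hit_ge0.
have -> : 1 = \int[P0]_w (1 : R).
  by rewrite Rintegral_cst//= probability_setT mulr1.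
apply: le_Rintegral => //; first exact: finite_measure_integrable_cst.
by move=> w _; exact: hit_le1.
Qed.

Let miss_integral : (\int[P0]_w (expR (- zero_ext f (scaled_energy w)))%:E = (1 - hit_prob)%:E)%E.
Proof.
have E w : expR (- zero_ext f (scaled_energy w)) = 1 - hit f (scaled_energy w).
  by rewrite /hit subKr.
under eq_integral do rewrite E EFinB.
have i1 : P0.-integrable setT (EFin \o cst (1 : R)) by exact: finite_measure_integrable_cst.
rewrite (integralB _ i1 ihit)//=.
rewrite integral_cst//= probability_setT mule1 EFinB; congr (_ - _)%E.
rewrite /hit_prob /Rintegral fineK//.
exact: integrable_fin_num.
Qed.

Let g w := expR (- \sum_i zero_ext f (a2^-1 * \sum_t X i t w ^+ 2)).

Let mzext : measurable_fun setT (zero_ext f).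
Proof. exact: continuous_measurable_fun (zero_ext_continuous hf). Qed.

Let g_integral : (\int[P]_w (g w)%:E = ((1 - hit_prob) ^+ p)%:E)%E.
Proof.
pose h (_ : 'I_p) (v : n.-tuple R) := expR (- zero_ext f (tuple_energy v)).
have gE w : g w = \prod_(i <- index_enum 'I_p) h i [tuple X i t w | t < n].
  rewrite /g -sumrN expR_sum; apply: eq_bigr => i _.
  by rewrite rowE.
under eq_integral do rewrite gE.
rewrite (integral_prod_indep (Y := fun i w => [tuple X i t w | t < n]) (g := h))//.
- rewrite (eq_bigr (fun=> (1 - hit_prob)%:E)); last first.
    move=> i _; rewrite -miss_integral -(@row_integral (fun x => expR (- zero_ext f x)) i)//.
      by apply: eq_integral => w _; rewrite /h rowE.
    by apply: measurableT_comp => //; exact: measurable_funN.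
  by rewrite prodEFin prodr_const card_ord.
- move=> i; apply: measurableT_comp => //; apply: measurable_funN.
  exact: measurableT_comp mzext mtuple_energy.
- by move=> i v; exact: expR_ge0.
- exact: index_enum_uniq.
Qed.

Variables (lam : 'I_p -> T -> R) (c del om r K : R).
Hypotheses (hlam : forall w,
    let M : 'M[R]_(p, n) := \matrix_(i, t) X i t w in
    eigenvalues_of (M *m M^T) (fun i => lam i w))
  (del0 : 0 < del) (delc : del <= c / 2) (om0 : 0 <= om) (r0 : 0 < r)
  (fc : forall x, x <= c -> zero_ext f x = 0)
  (fu : forall x y, `|x - y| <= del -> `|zero_ext f x - zero_ext f y| <= om)
  (K0 : 0 <= K) (hK : forall i t, (\int[P]_w (`|X i t w| `^ r)%:E <= K%:E)%E).

Definition overflow_bound : R :=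
  (del * a2) `^ (- r) * (p * n)%:R `^ (Num.max r 1 - 1) * (p%:R * (p * n)%:R * K ^+ 2).

(** Integrate eigenvalues_perturbation over the sample space. By independence the
    Laplace functional of the row energies is exactly (1 - hit_prob) ^ p. *)
Lemma laplace_rows : exists2 l : R,
  laplace P (fun w => fin_point_integral (fun i => a2^-1 * lam i w) f) = l%:E &
  `|l - (1 - hit_prob) ^+ p| <=
    overflow_bound + om * (p%:R * fine (P0 [set w | c / 2 < scaled_energy w])).
Proof.
pose F w := expR (- \sum_i zero_ext f (a2^-1 * lam i w)).
have lapE : laplace P (fun w => fin_point_integral (fun i => a2^-1 * lam i w) f) =
    (\int[P]_w (F w)%:E)%E.
  apply: eq_integral => w _.
  by rewrite /fin_point_integral sumEFin -EFinN.
pose N w : R := \sum_i (c / 2 < a2^-1 * \sum_t X i t w ^+ 2)%R%:R.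
pose e w := overflow r (del * a2) (fun i t => X i t w) + om * N w.
pose ind (x : R) : R := (c / 2 < x)%R%:R.
have mind : measurable_fun setT ind.
  rewrite (_ : ind = \1_(`]c / 2, +oo[%classic)); first exact: measurable_indic.
  apply/funext => x; rewrite /ind indicE; congr (nat_of_bool _)%:R.
  by apply/idP/idP; rewrite inE /= in_itv/= andbT.
have mindX i : measurable_fun setT (fun w => ind (a2^-1 * \sum_t X i t w ^+ 2)).
  rewrite (_ : (fun _ => _) = ind \o (tuple_energy \o (fun w => [tuple X i t w | t < n]))).
    by apply: measurableT_comp => //; exact: measurableT_comp.
  by apply/funext => w /=; rewrite rowE.
have mN : measurable_fun setT N by apply: measurable_sum.
have N0 w : 0 <= N w by exact: sumr_ge0.
have me : measurable_fun setT e.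
  apply: measurable_funD; first exact: measurable_overflow.
  exact: measurable_funM.
have e0 w : 0 <= e w by rewrite addr_ge0 ?overflow_ge0// mulr_ge0.
have mg : measurable_fun setT g.
  apply: measurableT_comp => //; apply: measurable_funN; apply: measurable_sum => i.
  rewrite (_ : (fun _ => _) = zero_ext f \o (tuple_energy \o (fun w => [tuple X i t w | t < n]))).
    by apply: measurableT_comp => //; exact: measurableT_comp.
  by apply/funext => w /=; rewrite rowE.
have Fge w : `|F w - g w| <= e w.
  exact: (eigenvalues_perturbation (hlam w) a20 del0 delc om0 r0
    (zero_ext_ge0 hf) fc fu).
have F0' w : 0 <= F w by exact: expR_ge0.
have g0' w : 0 <= g w by exact: expR_ge0.
have [] := integral_close P F0' g0' e0 mg me Fge.
rewrite g_integral.
have mlev : measurable [set w | c / 2 < scaled_energy w].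
  have := measurable_scaled_energy measurableT (measurable_itv `]c / 2, +oo[).
  by congr measurable; rewrite setTI; apply/seteqP; split => w /=; rewrite in_itv/= andbT.
have IN : (\int[P]_w (N w)%:E = (p%:R * fine (P0 [set w | c / 2 < scaled_energy w]%R))%:E)%E.
  rewrite /N; under eq_integral do rewrite -sumEFin.
  rewrite ge0_integral_sum//; last first.
    by move=> i; apply/measurable_EFinP; exact: mindX.
  rewrite (eq_bigr (fun=> (fine (P0 [set w | c / 2 < scaled_energy w]%R))%:E)).
    by rewrite sumEFin sumr_const card_ord mulr_natl.
  move=> i _; rewrite (row_integral i mind)// fineK; last exact: fin_num_measure.
  rewrite -[X in _ = P0 X]setIT -integral_indic//.
  apply: eq_integral => w _; rewrite /ind indicE; congr ((nat_of_bool _)%:R%:E).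
  by apply/idP/idP; rewrite inE.
have Ie : (\int[P]_w (e w)%:E <= (overflow_bound +
    om * (p%:R * fine (P0 [set w | c / 2 < scaled_energy w]%R)))%:E)%E.
  rewrite /e; under eq_integral do rewrite EFinD.
  rewrite ge0_integralD//; last 4 first.
  - by move=> w _; rewrite lee_fin overflow_ge0.
  - by apply/measurable_EFinP; exact: measurable_overflow.
  - by move=> w _; rewrite lee_fin mulr_ge0.
  - by apply/measurable_EFinP; exact: measurable_funM.
  rewrite [leRHS]EFinD; apply: leeD; first exact: integral_overflow_le.
  under eq_integral do rewrite EFinM.
  rewrite ge0_integralZl_EFin//; last 2 first.
  - by move=> w _; rewrite lee_fin.
  - exact/measurable_EFinP.
  by rewrite IN.
set B := _ + _ in Ie *.
move=> h1 h2.
have F1 : (\int[P]_w (F w)%:E <= 1)%E.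
  rewrite -(@probability_setT _ _ _ P) -[leRHS]mul1e -integral_cst//.
  apply: ge0_le_integral_nonmeas => w; first by rewrite lee_fin expR_ge0.
  rewrite lee_fin -expR0 ler_expR oppr_le0; apply: sumr_ge0 => i _.
  exact: zero_ext_ge0.
have F0 : (0 <= \int[P]_w (F w)%:E)%E by apply: integral_ge0 => w _; rewrite lee_fin expR_ge0.
have Ffin : (\int[P]_w (F w)%:E)%E \is a fin_num.
  by rewrite ge0_fin_numE// (le_lt_trans F1)// ltry.
exists (fine (\int[P]_w (F w)%:E)%E); first by rewrite lapE fineK.
move: h1 h2; rewrite -(fineK Ffin); set l := fine _ => h1 h2.
have h1' : l <= (1 - hit_prob) ^+ p + B.
  by rewrite -lee_fin EFinD (le_trans h1)// leeD2l.
have h2' : (1 - hit_prob) ^+ p <= l + B.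
  by rewrite -lee_fin [leRHS]EFinD (le_trans h2)// leeD2l.
rewrite ler_norml; move: h1' h2'; move: ((1 - hit_prob) ^+ p) l B {h1 h2 Ie} => z l B h1 h2.
by rewrite /=; apply/andP; split; lra.
Qed.

End fixed_size.

(** * Passage to the limit *)

Lemma cvg_fine_scaled (R : realType) (u : nat -> R) (v : nat -> \bar R) (l : R) :
  (forall n, v n \is a fin_num) ->
  ((u n)%:E * v n)%E @[n --> \oo] --> l%:E -> u n * fine (v n) @[n --> \oo] --> l.
Proof.
move=> vfin h; apply/cvg_EFinE; move: h.
by under [X in X @ _ --> _ -> _]eq_fun do rewrite -(fineK (vfin _)) -EFinM.
Qed.

Section tail_of_abs.
Context (R : realType) d (T : measurableType d) (P : probability T R) (Y : {RV P >-> R}).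

Definition abs_tail (x : R) : R := fine (P [set w | x < `|Y w|]).

Let mabs : measurable_fun setT (fun w => `|Y w|).
Proof. by apply: measurableT_comp => //; exact: measurable_funPT. Qed.

Lemma measurable_abs_level x : measurable [set w | x < `|Y w|].
Proof.
have := mabs measurableT (measurable_itv `]x, +oo[); congr measurable.
by rewrite setTI; apply/seteqP; split => w /=; rewrite in_itv/= andbT.
Qed.

Lemma abs_tail_ge0 x : 0 <= abs_tail x.
Proof. exact: fine_ge0. Qed.

Lemma abs_tail_mono x y : x <= y -> abs_tail y <= abs_tail x.
Proof.
move=> xy; apply: fine_le.
- by apply: fin_num_measure; exact: measurable_abs_level.
- by apply: fin_num_measure; exact: measurable_abs_level.
apply: le_measure; rewrite ?inE; [exact: measurable_abs_level|exact: measurable_abs_level|].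
by move=> w /=; exact: le_lt_trans.
Qed.

Lemma abs_tail_vanish : abs_tail x @[x --> +oo] --> 0.
Proof.
pose Z : {RV P >-> R} := HB.pack (fun w => `|Y w|) (isMeasurableFun.Build _ _ _ _ _ mabs).
have h := @cvg_ccdfy0 _ _ R P Z.
apply: fine_cvg.
have -> : (fun x => P [set w | x < `|Y w|]) = ccdf Z => //.
apply/funext => x; rewrite /ccdf /distribution /pushforward; congr (P _).
by apply/seteqP; split => w /=; rewrite in_itv/= andbT.
Qed.

End tail_of_abs.

Lemma stationary_marginal (R : realType) d (T : measurableType d)
    (P : probability T R) (X : nat -> {RV P >-> R}) (h : nat) (B : set R) :
  strictly_stationary P (fun t w => X t w) -> measurable B ->
  P (X h @^-1` B) = P (X 0%N @^-1` B).
Proof.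
move=> hX mB.
have mB' : measurable [set v : 1.-tuple R | B (tnth v ord0)].
  by rewrite -[X in measurable X]setTI; apply: measurable_tnth.
have := hX 1%N [tuple 0%N] h _ mB'.
rewrite /preimage/= => e; apply/esym; move: e.
by congr (P _ = P _); apply/seteqP; split => w /=; rewrite tnth_mktuple.
Qed.

Theorem theorem2p1 (R : realType)
  (* the stationary sequence *)
  (d0 : measure_display) (T0 : measurableType d0) (P0 : probability T0 R)
  (X : nat -> {RV P0 >-> R}) (alpha : R) (a : nat -> R)
  (hX : strictly_stationary P0 X)
  (halpha : 0 < alpha < 2)
  (ha : forall x : R, 0 < x ->
    (n%:R%:E * P0 [set w | (a n * x < `|X 0%N w|)%R])%E @[n --> \oo]
      --> (x `^ (- alpha))%:E)
  (hbal : cvg (fine (P0 [set w | x < X 0%N w]) /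
               fine (P0 [set w | x < `|X 0%N w|]) @[x --> +oo]))
  (* the number of rows *)
  (p : nat -> nat) (beta : R)
  (hp0 : forall n, (0 < p n)%N)
  (hp : p n @[n --> \oo] --> \oo)
  (hbeta0 : 0 < beta)
  (hbeta : 1 < alpha -> beta < (2 - alpha) / (alpha - 1))
  (hpbeta : (limn_esup (fun n => ((p n)%:R / n%:R `^ beta)%:E) < +oo)%E)
  (b : R) (hb0 : 0 <= b)
  (hb : forall x : R, 0 < x ->
    ((p n)%:R%:E * P0 [set w | (a (n * p n)%N ^+ 2 * x <
                               \sum_(1 <= t < n.+1) X t w ^+ 2)%R])%E
      @[n --> \oo] --> (b * x `^ (- (alpha / 2)))%:E)
  (* for each n, the p n x n random matrix; column t < n of the matrix
     corresponds to time t.+1 *)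
  (d : nat -> measure_display) (T : forall n, measurableType (d n))
  (P : forall n, probability (T n) R)
  (XX : forall n, 'I_(p n) -> 'I_n -> {RV (P n) >-> R})
  (hindep : forall n, mutually_independent (P n)
    (fun (i : 'I_(p n)) w => [tuple XX n i t w | t < n]))
  (hcopy : forall n (i : 'I_(p n)), eq_law (P n) P0
    (fun w => [tuple XX n i t w | t < n])
    (fun w => [tuple X t.+1 w | t < n]))
  (lambda : forall n, 'I_(p n) -> T n -> R)
  (hlambda : forall n (w : T n),
    let M : 'M[R]_(p n, n) := \matrix_(i, t) XX n i t w in
    eigenvalues_of (M *m M^T) (fun i => lambda n i w))
  (* the i.i.d. standard exponential variables; E k is the (k+1)-st of them *)
  (d1 : measure_display) (T1 : measurableType d1) (Q : probability T1 R)
  (E : nat -> {RV Q >-> R})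
  (hE : mutually_independent Q (fun k w => E k w))
  (hEexp : forall k (B : set R), measurable B ->
    distribution Q (E k) B = exponential_prob 1 B) :
  let Gamma i w := \sum_(k < i.+1) E k w in
  forall f : R -> R, pos_test_function f ->
    laplace (P n) (fun w =>
        fin_point_integral (fun i => (a (n * p n)%N ^+ 2)^-1 * lambda n i w) f)
      @[n --> \oo] -->
    laplace Q (fun w =>
        point_integral (fun i => b `^ (2 / alpha) *
                                 Gamma i w `^ (- (2 / alpha))) f).
Proof.
move=> Gamma f hf.
have [alpha0 alpha2] := andP halpha.
have ha' x : 0 < x -> n%:R * abs_tail (X 0%N) (a n * x) @[n --> \oo] --> x `^ (- alpha).
  move=> x0; apply: (cvg_fine_scaled (v := fun n => P0 [set w | (a n * x < `|X 0%N w|)%R])).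
    by move=> n; apply: fin_num_measure; exact: measurable_abs_level.
  exact: ha.
have Gmono := @abs_tail_mono _ _ _ _ (X 0%N).
have G0 := @abs_tail_ge0 _ _ _ _ (X 0%N).
have Gy := @abs_tail_vanish _ _ _ _ (X 0%N).
have agt0 := norming_gt0 Gmono alpha0 ha'.
have [r [s [/andP[r0 ralpha] salpha kap1 kapb]]] := exponent_choice halpha hbeta0 hbeta.
have s0 : 0 < s by exact: lt_trans salpha.
have [c1 c10 alow] := norming_lower Gmono G0 Gy alpha0 ha' salpha.
have mX t : measurable_fun setT (X t) by exact: measurable_funPT.
have [K K0 EK] : exists2 K, 0 <= K & (\int[P0]_w (`|X 0%N w| `^ r)%:E <= K%:E)%E.
  (* An exponent strictly between r and alpha, so that the moment of order r
  is a convergent geometric series. *)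
  pose r' := (r + alpha) / 2.
  have r'a : r' < alpha by rewrite /r'; lra.
  have [y0 y00 hy] := tail_dyadic_le Gmono G0 Gy alpha0 ha' r'a.
  apply: (moment_finite (mX 0%N) y00 (powR_ge0 2 (- r')) (G0 y0) r0).
    rewrite -powRD ?pnatr_eq0 ?implybT// -[ltRHS](powRr0 2) ltr_pow2R//.
    by rewrite /r'; lra.
  move=> k; rewrite -(@fineK _ (P0 _)); last first.
    by apply: fin_num_measure; exact: measurable_abs_level.
  by rewrite lee_fin; exact: hy.
have EXX n (i : 'I_(p n)) t : (\int[P n]_w (`|XX n i t w| `^ r)%:E <= K%:E)%E.
  apply: le_trans EK; rewrite le_eqVlt; apply/orP; left; apply/eqP.
  apply: (@eq_law_integral _ _ _ _ _ _ R (P n) P0 (XX n i t) (X 0%N)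
    (fun x => (`|x| `^ r)%:E)) => //.
  - move=> B mB.
    rewrite -(stationary_marginal t.+1 hX mB).
    have mB' : measurable [set v : n.-tuple R | B (tnth v t)].
      by rewrite -[X in measurable X]setTI; apply: measurable_tnth.
    apply: etrans (etrans (hcopy n i _ mB') _).
      by congr (P n _); apply/seteqP; split => w /=; rewrite tnth_mktuple.
    by congr (P0 _); apply/seteqP; split => w /=; rewrite tnth_mktuple.
  - apply/measurable_EFinP.
    by apply: (measurableT_comp (measurable_powR r)).
have [C C0 pC] := limn_esup_lty_bounded hpbeta.
have pC' : \forall n \near \oo, (p n)%:R <= C * n%:R `^ beta.
  near=> n; rewrite -ler_pdivrMr; first by near: n.
  by rewrite powR_gt0// ltr0n; near: n; exists 1%N.
have ovrate del : 0 < del -> (del * a (n * p n)%N ^+ 2) `^ (- r) *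
   (p n * n)%:R `^ (Num.max r 1 - 1) * ((p n)%:R * (p n * n)%:R * K ^+ 2) @[n --> \oo] --> (0:R).
  by move=> del0; apply: (overflow_rate K r0 s0 c10 C0 del0 kap1 kapb hp0 alow agt0 pC').
have Np : (n * p n)%N @[n --> \oo] --> \oo.
  move=> S [N _ NS]; exists N => // n /= Nn; apply: NS => /=.
  by rewrite (leq_trans Nn)// leq_pmulr.
have a2gt0 : \forall n \near \oo, 0 < a (n * p n)%N ^+ 2.
  by near=> n; rewrite exprn_gt0//; near: n; exact: (Np _ agt0).
pose a2 n := a (n * p n)%N ^+ 2.
pose Z n (t : 'I_n) : {RV P0 >-> R} := X t.+1.
pose S n := scaled_energy (Z n) (a2 n).
have SE n w : S n w = (a2 n)^-1 * \sum_(1 <= t < n.+1) X t w ^+ 2.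
  by rewrite /S /scaled_energy big_add1 big_mkord.
have mS n : measurable_fun setT (S n) by exact: measurable_scaled_energy.
have mSlev n x : measurable [set w | x < S n w].
  have := mS n measurableT _ (measurable_itv `]x, +oo[); congr measurable.
  by rewrite setTI; apply/seteqP; split => w /=; rewrite in_itv/= andbT.
have tails x : 0 < x -> (p n)%:R * fine (P0 [set w | x < S n w]) @[n --> \oo]
    --> b * x `^ (- (alpha / 2)).
  move=> x0.
  apply: (cvg_fine_scaled (u := fun n => (p n)%:R) (v := fun n => P0 [set w | x < S n w])).
    by move=> n; exact: fin_num_measure.
  apply: (cvg_trans _ (hb x x0)); apply: near_eq_cvg; near=> n.
  have an : 0 < a2 n by near: n.
  have E1 w : (x < S n w) = (a2 n * x < \sum_(1 <= t < n.+1) X t w ^+ 2).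
    by rewrite SE ltr_pdivlMl.
  by congr (_ * P0 _)%E; apply/seteqP; split => w /=; rewrite E1.
pose q := hit_intensity alpha b f.
have [c [C' [c0 cC' fc fC']]] := zero_ext_support hf.
have qcont : continuous q by exact: hit_intensity_continuous.
have [M qM] := hit_intensity_right alpha0 hb0 hf.
have zcont := zero_ext_continuous hf.
have hunif eps : 0 < eps -> exists2 eta, 0 < eta &
    forall x y, `|x - y| <= eta -> `|hit f x - hit f y| <= eps.
  move=> eps0; apply: (unif_continuous_support (c := c) (C := C')) => //.
  - exact: hit_continuous.
  - by move=> x xc; rewrite hit_eq0// fc.
  - by move=> x xC; rewrite hit_eq0// fC'.
pose I := \int[lebesgue_measure]_x q x.
(* The expected number of marked rows converges to the limiting intensity. *)
have pu : (p n)%:R * hit_prob (Z n) f (a2 n) @[n --> \oo] --> I.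
  rewrite /I /q -integral_hit_intensity.
  apply: (vague_cvg_tails (h := hit f) (c := c) (C := C') (S := S)
    (p := fun n => (p n)%:R)) => //.
  - by move=> x xc; rewrite hit_eq0// fc.
  - by move=> x xC; rewrite hit_eq0// fC'.
  - exact: continuous_measurable_fun (hit_continuous hf).
  - exact: measurable_point_map.
  - by apply: (eq_ind_r (fun e => (e < +oo)%E) _ (upper_mass_point_map alpha0 hb0 c0)); exact: ltry.
  - move=> x cx; have x0 : 0 < x by exact: lt_le_trans cx.
    have -> : upper_mass lebesgue_measure `]0, +oo[%classic (point_map alpha b) x =
        b * x `^ (- (alpha / 2)).
      exact: (congr1 fine (upper_mass_point_map alpha0 hb0 x0)).
    exact: tails.
have powlim : (1 - hit_prob (Z n) f (a2 n)) ^+ p n @[n --> \oo] --> expR (- I).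
  by apply: cvg_one_sub_pow => // n; exact: hit_prob01.
have rhs : laplace Q (fun w => point_integral (fun i => b `^ (2 / alpha) *
      Gamma i w `^ (- (2 / alpha))) f) = (expR (- I))%:E.
  pose phi := zero_ext f \o point_map alpha b.
  have mphi : measurable_fun setT phi.
    exact: measurableT_comp (continuous_measurable_fun zcont) (measurable_point_map alpha b).
  have phi0 x : 0 <= phi x by exact: zero_ext_ge0.
  have q0 : forall x, 0 <= q x by exact: hit_intensity_ge0.
  have q1 : forall x, q x <= 1 by exact: hit_intensity_le1.
  have qL : forall x, x <= 0 -> q x = 0 by exact: hit_intensity_le0.
  have qE x : 0 <= x -> q x = 1 - expR (- phi x) by exact: hit_intensityE.
  exact: (laplace_poisson hE hEexp qcont q0 q1 qL qM mphi phi0 qE).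
rewrite rhs.
(* The error of laplace_rows splits into the expected overflow, the modulus of
continuity times the expected number of rows of energy beyond c / 2, which
is eventually below B, and the error of the Poisson approximation. *)
have main eps : 0 < eps -> \forall n \near \oo, exists2 l,
    laplace (P n) (fun w => fin_point_integral (fun i => (a2 n)^-1 * lambda n i w) f) = l%:E &
    `|l - expR (- I)| <= eps.
  move=> eps0.
  have e30 : 0 < eps / 3 by rewrite divr_gt0.
  pose B := b * (c / 2) `^ (- (alpha / 2)) + 1.
  have B0 : 0 < B by rewrite ltr_wpDl// mulr_ge0 ?powR_ge0.
  have om0 : 0 < eps / 3 / B by rewrite divr_gt0.
  have [eta eta0 heta] := unif_continuous_support zcont fc fC' om0.
  have c20 : 0 < c / 2 by rewrite divr_gt0.
  pose del := Num.min eta (c / 2).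
  have del0 : 0 < del by rewrite lt_min eta0.
  near=> n.
  have an : 0 < a2 n by near: n.
  have fu x y : `|x - y| <= del -> `|zero_ext f x - zero_ext f y| <= eps / 3 / B.
    by rewrite le_min => /andP[xy _]; exact: heta.
  have delc : del <= c / 2 by rewrite ge_min lexx orbT.
  have [l lE hl] := laplace_rows (hindep n) (hcopy n) hf an (hlambda n) del0 delc
    (ltW om0) r0 fc fu K0 (EXX n).
  exists l => //; apply: le_trans (ler_distD ((1 - hit_prob (Z n) f (a2 n)) ^+ p n) _ _) _.
  have h1 : `|(1 - hit_prob (Z n) f (a2 n)) ^+ p n - expR (- I)| <= eps / 3.
    by rewrite distrC; near: n; move/cvgrPdist_le : powlim; apply.
  have h2 : overflow_bound (p n) n (a2 n) del r K <= eps / 3.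
    rewrite (le_trans (ler_norm _))// -normrN -sub0r.
    by near: n; move/cvgrPdist_le : (ovrate del del0); apply.
  have h3 : eps / 3 / B * ((p n)%:R * fine (P0 [set w | c / 2 < S n w])) <= eps / 3.
    rewrite -[leRHS](divfK (lt0r_neq0 B0)) ler_pM2l// /B.
    near: n; move/cvgrPdist_le : (tails _ c20) => /(_ 1 ltr01).
    apply: filterS => n; rewrite ler_norml => /andP[+ _].
    by rewrite lerBrDr addrC lerBlDr.
  have h4 := le_trans hl (lerD h2 h3).
  by rewrite (le_trans (lerD h4 h1))//; lra.
apply/fine_cvgP; split.
  apply: filterS (main 1 ltr01) => n [l lE _].
  by rewrite (lE : laplace _ _ = _).
apply/cvgrPdist_le => eps eps0.
apply: filterS (main eps eps0) => n [l lE hl].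
by rewrite /= (lE : laplace _ _ = _) /= distrC.
Unshelve. all: by end_near. Qed.
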